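(* Let $M$ be a non-degenerate (real) $d\times d$ matrix and $\delta\in(0,1]$. Suppose that 1) $\operatorname{supp}\widehat\varphi\subset\mathbb{T}^d$ and $\widehat\varphi\in L_\infty$; 2) $\Big|\dfrac{\partial\widehat\varphi}{\partial x_l}(\xi)\Big|\le B$ for all $\xi\in\mathbb{R}^d$ and $l=1,\dots,d$, for some constant $B$; 3) $\widetilde\varphi\in\mathcal{S}'$ and $\widehat{\widetilde\varphi}$ is bounded on $\delta\mathbb{T}^d$; 4) $\varphi$ and $\widetilde\varphi$ are strictly compatible with parameter $\delta$, i.e. $\overline{\widehat\varphi}(\xi)\,\widehat{\widetilde\varphi}(\xi)=1$ for almost every $\xi\in\delta\mathbb{T}^d$. If a function $f$ is such that $\operatorname{supp}\widehat f\subset\delta M^*\mathbb{T}^d$ and $\widehat f\in L_1$, then $$f(x)=\lim_{n\to\infty}\sum_{k\in\mathbb{Z}^d,\ \|k\|_\infty\le n}\langle\widehat f,\widehat{\widetilde\varphi_{1k}}\rangle\,\varphi_{1k}(x)\quad\text{for all }x\in\mathbb{R}^d.$$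
   Context: $\mathbb{T}^d$ is identified with the cube $[-1/2,1/2]^d$; $L_q=L_q(\mathbb{R}^d)$; $M^*$ is the conjugate matrix of $M$ and $m=|\det M|$; $\|k\|_\infty=\max_i|k_i|$. $\mathcal{S}'$ is the space of tempered distributions on $\mathbb{R}^d$. $\widehat f(\xi)=\int_{\mathbb{R}^d}f(x)e^{-2\pi i(x,\xi)}dx$ (extended to tempered distributions by $\langle\widehat f,\widehat\phi\rangle=\langle f,\phi\rangle$ for Schwartz $f$, where $\langle f,\phi\rangle=\phi(f)$); $\langle f,g\rangle=\int f\overline g$ for functions. Since $\widehat f$ and $\widehat\varphi$ are integrable, $f$ and $\varphi$ are understood as the continuous functions given by the inverse Fourier integrals $f(x)=\int\widehat f(\xi)e^{2\pi i(x,\xi)}d\xi$, $\varphi(x)=\int\widehat\varphi(\xi)e^{2\pi i(x,\xi)}d\xi$. $\widehat{\widetilde\varphi}$ being bounded on $\delta\mathbb{T}^d$ means that it is there given by a bounded measurable function. $\varphi_{1k}(x)=m^{1/2}\varphi(Mx+k)$. Correspondingly $\widehat{\widetilde\varphi_{1k}}(\xi)=m^{-1/2}\,\widehat{\widetilde\varphi}((M^* )^{-1}\xi)\,e^{2\pi i(k,(M^* )^{-1}\xi)}$, so that $$\langle\widehat f,\widehat{\widetilde\varphi_{1k}}\rangle=m^{-1/2}\int_{\delta M^*\mathbb{T}^d}\widehat f(\xi)\,\overline{\widehat{\widetilde\varphi}((M^* )^{-1}\xi)}\,e^{-2\pi i(k,(M^* )^{-1}\xi)}\,d\xi.$$ 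*)

(* Defs.v *)
From HB Require Import structures.
From mathcomp Require Import all_boot all_order all_algebra.
From mathcomp Require Import complex.
From mathcomp Require Import all_classical all_reals all_analysis.

Set Implicit Arguments.
Unset Strict Implicit.
Unset Printing Implicit Defensive.

Import Order.TTheory GRing.Theory Num.Theory.
Import numFieldNormedType.Exports.

Local Open Scope classical_set_scope.
Local Open Scope complex_scope.
Local Open Scope ring_scope.

(* A point of R^d is a column vector 'cV[R]_d = 'M[R]_(d, 1).  The library
   gives matrices the max norm and its topology but no sigma-algebra; as for
   tuples, we take the one generated by the entries, which over R is the
   Borel one. *)

Definition measure_matrix_display : measure_display -> measure_display.
Proof. exact. Qed.

Section measurable_matrix.
Context {disp : measure_display} {T : measurableType disp} (m n : nat).

Definition cylinder_mx : set (set 'M[T]_(m, n)) :=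
  [set A | exists (i : 'I_m) (j : 'I_n) (B : set T),
    measurable B /\ A = [set x : 'M[T]_(m, n) | B (x i j)]].

Let measurable_mx0 : <<s cylinder_mx >> set0.
Proof. exact: sigma_algebra0. Qed.

Let measurable_mxC A : <<s cylinder_mx >> A -> <<s cylinder_mx >> (~` A).
Proof. exact: sigma_algebraC. Qed.

Let measurable_mx_bigcup (F : (set 'M[T]_(m, n))^nat) :
  (forall i, <<s cylinder_mx >> (F i)) -> <<s cylinder_mx >> (\bigcup_i F i).
Proof. exact: sigma_algebra_bigcup. Qed.

HB.instance Definition _ := @isMeasurable.Build (measure_matrix_display disp)
  'M[T]_(m, n) <<s cylinder_mx >>
  measurable_mx0 measurable_mxC measurable_mx_bigcup.

End measurable_matrix.


Section lebesgue_measure_cV.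
Context {R : realType}.

Lemma measurable_coord d (i : 'I_d) :
  measurable_fun setT (fun x : 'cV[R]_d => x i ord0).
Proof.
move=> _ B mB; rewrite setTI; apply: sub_sigma_algebra.
by exists i, ord0, B.
Qed.

Lemma measurable_cV disp (T : measurableType disp) d (f : T -> 'cV[R]_d) :
  (forall i, measurable_fun setT (fun x => f x i ord0)) -> measurable_fun setT f.
Proof.
move=> mf; apply: (@measurability _ _ _ _ setT f (@cylinder_mx _ R d 1)) => //.
move=> _ [_ [i [j [B [mB ->]]]] <-].
by rewrite (ord1 j); exact: mf.
Qed.

Definition cons_cV d (p : measurableTypeR R * 'cV[R]_d) : 'cV[R]_d.+1 := col_mx p.1%:M p.2.

Definition uncons_cV d (x : 'cV[R]_d.+1) : measurableTypeR R * 'cV[R]_d :=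
  (x ord0 ord0, \col_k x (lift ord0 k) ord0).

Lemma cons_cV0 d (p : measurableTypeR R * 'cV[R]_d) : cons_cV p ord0 ord0 = p.1.
Proof.
rewrite /cons_cV (_ : ord0 = @lshift 1 d ord0); last exact/val_inj.
by rewrite (@col_mxEu R 1 d) mxE eqxx mulr1n.
Qed.

Lemma cons_cVS d (p : measurableTypeR R * 'cV[R]_d) (k : 'I_d) :
  cons_cV p (lift ord0 k) ord0 = p.2 k ord0.
Proof.
rewrite /cons_cV (_ : lift ord0 k = @rshift 1 d k); last exact/val_inj.
by rewrite (@col_mxEd R 1 d).
Qed.

Lemma cons_cVK d : cancel (@cons_cV d) (@uncons_cV d).
Proof.
move=> [a y]; rewrite /uncons_cV cons_cV0; congr pair.
by apply/colP => k; rewrite mxE cons_cVS.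
Qed.

Lemma measurable_cons_cV d : measurable_fun setT (@cons_cV d).
Proof.
apply: measurable_cV => i; case: (unliftP ord0 i) => [k ->|->].
  under eq_fun do rewrite cons_cVS.
  apply: (@measurableT_comp _ _ _ _ _ _ (fun x : 'cV[R]_d => x k ord0)) => //.
  exact: measurable_coord.
by under eq_fun do rewrite cons_cV0; exact: measurable_fst.
Qed.

Lemma measurable_uncons_cV d : measurable_fun setT (@uncons_cV d).
Proof.
apply: measurable_fun_pair; first exact: measurable_coord.
apply: measurable_cV => k; under eq_fun do rewrite mxE.
exact: measurable_coord.
Qed.

Section step.
Context d (mu : {sigma_finite_measure set 'cV[R]_d -> \bar R}).

Definition lebesgue_step : set 'cV[R]_d.+1 -> \bar R :=
  pushforward (lebesgue_measure \x mu)%E (@cons_cV d).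

Let mcons A : measurable A -> measurable (@cons_cV d @^-1` A).
Proof.
by move=> mA; rewrite -[X in measurable X]setTI; apply: measurable_cons_cV.
Qed.

Let step0 : lebesgue_step set0 = 0%E.
Proof. by rewrite /lebesgue_step /pushforward preimage_set0 measure0. Qed.

Let step_ge0 A : (0 <= lebesgue_step A)%E.
Proof. exact: (measure_ge0 (lebesgue_measure \x mu)%E). Qed.

Let step_sigma_additive : semi_sigma_additive lebesgue_step.
Proof.
move=> F mF tF mUF; rewrite /lebesgue_step /pushforward preimage_bigcup.
apply: measure_semi_sigma_additive.
- by move=> n; exact: mcons.
- apply/trivIsetP => /= i j _ _ ij; rewrite -preimage_setI.
  by move/trivIsetP : tF => /(_ _ _ _ _ ij) ->//; rewrite preimage_set0.
- by rewrite -preimage_bigcup; exact: mcons.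
Qed.

HB.instance Definition _ := isMeasure.Build _ _ _ lebesgue_step
  step0 step_ge0 step_sigma_additive.

Let step_sigma_finite : sigma_finite setT lebesgue_step.
Proof.
have /sigma_finiteP[F [FT ndF Foo]] :=
  sigma_finiteT (lebesgue_measure :
    {sigma_finite_measure set (measurableTypeR R) -> \bar R}).
have /sigma_finiteP[G [GT ndG Goo]] := sigma_finiteT mu.
exists (fun n => @uncons_cV d @^-1` (F n `*` G n)).
  apply/seteqP; split => // x _.
  have [i _ Fi] : (\bigcup_i F i) (uncons_cV x).1 by rewrite -FT.
  have [j _ Gj] : (\bigcup_j G j) (uncons_cV x).2 by rewrite -GT.
  exists (maxn i j) => //; split.
    by move: Fi; exact/subsetPset/ndF/leq_maxl.
  by move: Gj; exact/subsetPset/ndG/leq_maxr.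
move=> n; have [mF Fn] := Foo n; have [mG Gn] := Goo n; split.
  rewrite -[X in measurable X]setTI; apply: measurable_uncons_cV => //.
  exact: measurableX.
rewrite /lebesgue_step /pushforward -comp_preimage.
rewrite (_ : _ \o _ = id); last by apply/funext => p; exact: cons_cVK.
by rewrite preimage_id product_measure1E// lte_mul_pinfty// ge0_fin_numE.
Qed.

HB.instance Definition _ := Measure_isSigmaFinite.Build _ _ _ lebesgue_step
  step_sigma_finite.

End step.

(* Lebesgue measure on R^d, as the d-fold product of the one on R *)
Fixpoint lebesgue_cV (d : nat) : {sigma_finite_measure set 'cV[R]_d -> \bar R} :=
  if d is d'.+1 then lebesgue_step (lebesgue_cV d') else \d_(0 : 'cV[R]_0).

Lemma lebesgue_cV_box d (A : 'I_d -> set R) :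
  (forall i, measurable (A i)) ->
  lebesgue_cV d [set x | forall i, A i (x i ord0)] =
  (\prod_(i < d) lebesgue_measure (A i))%E.
Proof.
elim: d A => [|d IH] A mA.
  rewrite big_ord0 /= diracE mem_set// => -[]//.
have mbox (e : nat) (B : 'I_e -> set R) : (forall i, measurable (B i)) ->
    measurable [set x : 'cV[R]_e | forall i, B i (x i ord0)].
  move=> mB; rewrite (_ : [set _ | _] =
      \bigcap_(i in [set: 'I_e]) ((fun x : 'cV[R]_e => x i ord0) @^-1` B i)).
    apply: fin_bigcap_measurable => // i _.
    by rewrite -[X in measurable X]setTI; exact: measurable_coord.
  by apply/seteqP; split => x /= h i => [_|]; exact: h.
rewrite big_ord_recl -(IH (fun k => A (lift ord0 k)))//.
have mA0 : measurable (A ord0 : set (measurableTypeR R)) by exact: (mA ord0).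
have mAS := mbox d (fun k => A (lift ord0 k)) (fun k => mA (lift ord0 k)).
rewrite -(product_measure1E
  (lebesgue_measure : {measure set (measurableTypeR R) -> \bar R}) _ mA0 mAS).
rewrite /= /lebesgue_step /pushforward; congr (_ _).
apply/seteqP; split => [p /= h|p /= [h0 h] i].
  by split => [|k]; [rewrite -cons_cV0|rewrite -cons_cVS]; exact: h.
by case: (unliftP ord0 i) => [k ->|->]; rewrite ?cons_cV0 ?cons_cVS; [exact: h|].
Qed.

End lebesgue_measure_cV.

Notation normc := ComplexField.Normc.normc.

Section complex_functions.
Context {R : realType} {d : nat}.
Let E := 'cV[R]_d.
Let mu := @lebesgue_cV R d.
Implicit Types (u v : E -> R[i]) (x xi : E) (l : 'I_d).

Definition cmeasurable_fun (D : set E) u : Prop :=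
  measurable_fun D (fun x => complex.Re (u x)) /\
  measurable_fun D (fun x => complex.Im (u x)).

(* u is (a representative of an element) of L_p(R^d) *)
Definition in_Lp (p : \bar R) u : Prop :=
  cmeasurable_fun setT u /\ ('N[mu]_p[(fun x => (normc (u x))%:E)] < +oo)%E.

Definition cintegral (D : set E) u : R[i] :=
  (\int[mu]_(x in D) complex.Re (u x)) +i* (\int[mu]_(x in D) complex.Im (u x)).

(* support of a class of functions modulo a.e. equality: the complement of the
   largest open set on which u vanishes a.e. *)
Definition supp u : set E :=
  ~` \bigcup_(U in [set U : set E | open U /\
                      {ae mu, forall x, U x -> u x = 0}]) U.

Definition basis_vec l : E := delta_mx l ord0.

Definition has_partial l u x : Prop :=
  derivable (fun y : E => complex.Re (u y)) x (basis_vec l) /\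
  derivable (fun y : E => complex.Im (u y)) x (basis_vec l).

Definition partial l u : E -> R[i] := fun x =>
  ('D_(basis_vec l) (fun y : E => complex.Re (u y)) x) +i*
  ('D_(basis_vec l) (fun y : E => complex.Im (u y)) x).

Definition partials (s : seq 'I_d) u : E -> R[i] := foldr partial u s.

Definition inner x xi : R := \sum_(i < d) x i ord0 * xi i ord0.

(* e^{2 pi i t} *)
Definition e2pi (t : R) : R[i] :=
  (cos (2 * pi * t)) +i* (sin (2 * pi * t)).

Definition fourier u : E -> R[i] := fun xi =>
  cintegral setT (fun x => u x * e2pi (- inner x xi)).

Definition inv_fourier u : E -> R[i] := fun x =>
  cintegral setT (fun xi => u xi * e2pi (inner x xi)).

(* <u, v> over D *)
Definition pairing (D : set E) u v : R[i] :=
  cintegral D (fun x => u x * (v x)^*).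

(* Boundedness of all the partial derivatives makes them Lipschitz, so that
   such a function is C^oo. *)
Definition schwartz u : Prop :=
  (forall s l x, has_partial l (partials s u) x) /\
  (forall s (N : nat), exists C : R, forall x,
     (1 + `|x|) ^+ N * normc (partials s u x) <= C).

(* the seminorm sup_(size s <= N) sup_x (1 + |x|)^N |partials s u x| is at
   most c; for N and c varying these sets form a basis of neighbourhoods of 0
   in the Schwartz space *)
Definition schwartz_ball (N : nat) (c : R) u : Prop :=
  schwartz u /\
  forall s x, (size s <= N)%N -> (1 + `|x|) ^+ N * normc (partials s u x) <= c.

(* Distributions are functionals of which only the values on Schwartz functions
   matter; T u is what is written <u, T>. *)
Definition tempered (T : (E -> R[i]) -> R[i]) : Prop :=
  (forall (a : R[i]) u v, schwartz u -> schwartz v ->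
     T (fun x => a * u x + v x) = a * T u + T v) /\
  (forall e : R, 0 < e -> exists N (c : R), 0 < c /\
     forall u, schwartz_ball N c u -> normc (T u) <= e).

Definition is_dist_fourier (T That : (E -> R[i]) -> R[i]) : Prop :=
  tempered That /\ forall u, schwartz u -> That (fourier u) = T u.

(* T coincides with the function g on the interior of D; a function g defines
   the distribution u |-> <u, g>, with a conjugate on g. *)
Definition dist_given_on (D : set E) (T : (E -> R[i]) -> R[i]) (g : E -> R[i]) :
    Prop :=
  forall u, schwartz u -> closure [set x | u x != 0] `<=` D° ->
    T u = pairing D u g.

(* the torus, identified with the cube [-1/2, 1/2]^d *)
Definition torus : set E := [set x | forall i, `|x i ord0| <= 2^-1].

Definition dtorus (delta : R) : set E := [set delta *: x | x in torus].

(* delta M^* T^d *)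
Definition dMtorus (M : 'M[R]_d) (delta : R) : set E :=
  [set M^T *m x | x in dtorus delta].

(* m^{1/2}, where m = |det M| *)
Definition sqrt_m (M : 'M[R]_d) : R[i] := (Num.sqrt `|\det M|)%:C.

(* u_{1k}(x) = m^{1/2} u(Mx + k) *)
Definition dilate (M : 'M[R]_d) (k : 'cV[int]_d) u : E -> R[i] := fun x =>
  sqrt_m M * u (M *m x + map_mx intr k).

(* the Fourier transform of u_{1k}, in terms of the Fourier transform g of u *)
Definition dilate_hat (M : 'M[R]_d) (k : 'cV[int]_d) (g : E -> R[i]) :
    E -> R[i] := fun xi =>
  let eta := invmx M^T *m xi in
  (sqrt_m M)^-1 * g eta * e2pi (inner (map_mx intr k) eta).

End complex_functions.

(* Main.v *)
Require Import Defs.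
From HB Require Import structures.
From mathcomp Require Import all_boot all_order all_algebra.
From mathcomp Require Import complex.
From mathcomp Require Import all_classical all_reals all_analysis.
From mathcomp Require Import measurable_realfun ring lra zify.

Set Implicit Arguments.
Unset Strict Implicit.
Unset Printing Implicit Defensive.

Import Order.TTheory GRing.Theory Num.Theory.
Import numFieldNormedType.Exports.

Local Open Scope classical_set_scope.
Local Open Scope complex_scope.
Local Open Scope ring_scope.

(** Put y = M x and, for a frequency xi, eta = (M^T)^-1 xi.  Every coefficient
is an integral over xi, so the partial sum of order n is the single integral of
fhat(xi) conj(g(eta)) S_n(eta) over delta M^* T^d, where
  S_n(eta) = \sum_(|k| <= n) phi(y + k) e^(- 2 pi i (k, eta)).
Since phi(y + k) is the Fourier coefficient of index - k of
h(z) = phihat(z) e^(2 pi i (y, z)), S_n is a cubic partial sum of the Fourier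
series of h, that is, the integral of h against a product of Dirichlet kernels
([lattice_sumE]).  On the other side, phihat conj(g) = 1 almost everywhere on
delta T^d and (M x, eta) = (x, xi), so f(x) is the integral of
fhat(xi) conj(g(eta)) h(eta).  As fhat is integrable and g bounded, it remains
to see that S_n tends to h uniformly on the torus.

The function h is Lipschitz in each variable and vanishes off the torus, so its
periodization is Lipschitz too.  In dimension one, the partial sums of a
Lipschitz function converge at the rate n^(- 1/2) ([dirichlet_approx]), and the
L^1 norm of the Dirichlet kernel is at most of order log n
([Rintegral_normr_dirichlet]).  In dimension d the one-dimensional partial sums
are taken one coordinate after the other: the error made in a coordinate is at
most of order n^(- 1/2), and each of the partial sums in the other coordinates
multiplies it by at most a logarithm.  The total is of order
n^(- 1/2) (log n)^d ([cube_sum_approx]), which tends to 0 ([dirichlet_rate]).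

Three facts of measure theory link this to the hypotheses.  The compatibility
relation holds for almost every eta and is used for almost every xi, which
requires that invertible linear maps pull null sets back to null sets
([negligible_preimage_mulmx]); fhat vanishes almost everywhere off its support
([ae_zero_off_supp]); and phihat, being continuous, vanishes everywhere off its
support ([coord_lipschitz_ae_zero]). *)

(** * The Dirichlet kernel *)

Section kernel.
Context {R : realType}.
Implicit Types (t : R) (n : nat).

Definition dirichlet n t : R := \sum_(j < n.*2.+1) cos (2 * pi * (j%:R - n%:R) * t).

Lemma natr_oddE n : n.*2.+1%:R = 2 * n%:R + 1 :> R.
Proof. by rewrite -natr1 -muln2 natrM mulrC. Qed.

Lemma dirichlet_le n t : `|dirichlet n t| <= n.*2.+1%:R.
Proof.
apply: le_trans (ler_norm_sum _ _ _) _.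
apply: (le_trans (ler_sum _ (fun j _ => cos_max _))).
by rewrite sumr_const card_ord.
Qed.

Lemma cos_shift_int (x : R) (j n : nat) :
  cos (x + 2 * pi * (j%:R - n%:R)) = cos x.
Proof.
rewrite -[LHS](periodicn (@cosD2pi R) n) -[RHS](periodicn (@cosD2pi R) j).
suff -> : x + 2 * pi * (j%:R - n%:R) + pi *+ 2 *+ n = x + pi *+ 2 *+ j by [].
rewrite -!(mulr_natr (pi *+ 2)) -(mulr_natr pi); ring.
Qed.

Lemma sin_shift_int (x : R) (j n : nat) :
  sin (x + 2 * pi * (j%:R - n%:R)) = sin x.
Proof.
rewrite -[LHS](periodicn (@sinD2pi R) n) -[RHS](periodicn (@sinD2pi R) j).
suff -> : x + 2 * pi * (j%:R - n%:R) + pi *+ 2 *+ n = x + pi *+ 2 *+ j by [].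
rewrite -!(mulr_natr (pi *+ 2)) -(mulr_natr pi); ring.
Qed.

Lemma dirichletD1 n t : dirichlet n (t + 1) = dirichlet n t.
Proof.
by apply: eq_bigr => j _; rewrite mulrDr mulr1 cos_shift_int.
Qed.

Lemma dirichletB1 n t : dirichlet n (t - 1) = dirichlet n t.
Proof. by rewrite -[in RHS](subrK 1 t) dirichletD1. Qed.

(** The product formula for sin times cos makes the sum telescope. *)
Lemma sin_dirichlet n t :
  sin (pi * t) * dirichlet n t = sin (pi * n.*2.+1%:R * t).
Proof.
pose a (j : nat) : R := sin (pi * (2 * (j%:R - n%:R) - 1) * t) / 2.
have tele j : sin (pi * t) * cos (2 * pi * (j%:R - n%:R) * t) = a j.+1 - a j.
  rewrite /a -mulrBl.
  have -> : pi * (2 * (j.+1%:R - n%:R) - 1) * t =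
     2 * pi * (j%:R - n%:R) * t + pi * t by rewrite -natr1; ring.
  have -> : pi * (2 * (j%:R - n%:R) - 1) * t =
     2 * pi * (j%:R - n%:R) * t - pi * t by ring.
  by rewrite sinD sinB; field.
rewrite /dirichlet mulr_sumr; under eq_bigr do rewrite tele.
rewrite -(big_mkord xpredT (fun j => a j.+1 - a j)) telescope_sumr// /a.
have -> : pi * (2 * (n.*2.+1%:R - n%:R) - 1) * t = pi * n.*2.+1%:R * t.
  by rewrite natr_oddE; ring.
have -> : pi * (2 * (0%:R - n%:R) - 1) * t = - (pi * n.*2.+1%:R * t).
  by rewrite natr_oddE; ring.
by rewrite sinN; field.
Qed.

Lemma sin_lipschitz (x y : R) : `|sin x - sin y| <= `|x - y|.
Proof.
wlog yx : x y / y <= x.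
  by move=> H; case: (leP y x) => [|/ltW]; [|rewrite distrC (distrC x)]; exact: H.
have [c _ ->] := MVT_segment yx (fun z _ => is_derive_sin z)
  (continuous_subspaceT (@continuous_sin R)).
rewrite normrM ler_piMl//; exact: cos_max.
Qed.

Lemma cos_lipschitz (x y : R) : `|cos x - cos y| <= `|x - y|.
Proof.
have := sin_lipschitz (x + pi / 2) (y + pi / 2).
by rewrite !sinDpihalf opprD addrACA subrr addr0.
Qed.

(** A weak form of the concavity of the sine: sin x >= x / 2 up to x = 1, by the
mean value theorem and 1 - cos c <= c ^ 2 / 2, and sin x >= sin 1 >= 1 / 2 from
there to pi / 2. *)
Lemma norm_le_sin_pi t : `|t| <= 2^-1 -> `|t| <= `|sin (pi * t)|.
Proof.
wlog t0 : t / 0 <= t.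
  move=> H; case: (leP 0 t) => [|/ltW t0]; first exact: H.
  by have := H (- t); rewrite oppr_ge0 mulrN sinN !normrN => /(_ t0).
rewrite (ger0_norm t0) => t2.
have pi2 := pi_ge2 R; have pih1 := pihalf_ge1 R; have pi0 := pi_gt0 R.
have sin_ge (x : R) : 0 <= x <= 1 -> x / 2 <= sin x.
  move=> /andP[x0 x1].
  have [c] := MVT_segment x0 (fun z _ => is_derive_sin z)
    (continuous_subspaceT (@continuous_sin R)).
  rewrite in_itv/= sin0 !subr0 => /andP[c0 cx] ->.
  have : 1 - cos c <= c ^+ 2 / 2.
    have -> : c = (c / 2) *+ 2 by rewrite -mulr_natr; field.
    rewrite cos_mulr2n cos2sin2.
    have : `|sin (c / 2)| <= `|c / 2|.
      by have := sin_lipschitz (c / 2) 0; rewrite sin0 !subr0.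
    rewrite -ler_sqr ?nnegrE// !real_normK ?num_real//; lra.
  nra.
rewrite (le_trans _ (ler_norm _))//.
have [pt1|pt1] := leP (pi * t) 1.
  apply: le_trans (sin_ge _ _); first by nra.
  by rewrite pt1 mulr_ge0// ltW.
apply: (@le_trans _ _ (sin 1)).
  by apply: (le_trans t2); rewrite -[X in X <= _]div1r sin_ge; lra.
rewrite ltW// ltr_sin ?in_itv//=.
- by apply/andP; split; lra.
- by apply/andP; split; nra.
Qed.

(** Together with [dirichlet_le], this bounds the kernel by the minimum of its
number of terms and 1 / |t| on a period. *)
Lemma dirichlet_le_inv n t : `|t| <= 2^-1 -> `|t| * `|dirichlet n t| <= 1.
Proof.
move=> t2; apply: le_trans (sin_max (pi * n.*2.+1%:R * t)).
by rewrite -sin_dirichlet normrM ler_wpM2r ?norm_le_sin_pi.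
Qed.

Lemma measurable_cos : measurable_fun setT (@cos R).
Proof. by apply: continuous_measurable_fun; exact: continuous_cos. Qed.

Lemma measurable_sin : measurable_fun setT (@sin R).
Proof. by apply: continuous_measurable_fun; exact: continuous_sin. Qed.

Lemma measurable_dirichlet n : measurable_fun setT (dirichlet n).
Proof.
apply: measurable_sum => j; apply: (measurableT_comp measurable_cos).
exact: measurable_funM.
Qed.

End kernel.

(** * Bounded functions supported on a set of finite measure *)

Section tame.
Context {disp : measure_display} {T : measurableType disp} {R : realType}.
Variable mu : {measure set T -> \bar R}.
Implicit Types f g : T -> R.

(** A class stable under all the operations used on integrands, on which the
real-valued integral is linear and monotone without further side conditions. *)
Definition tame f : Prop := [/\ measurable_fun setT f,
  exists C, forall x, `|f x| <= C &
  exists S, [/\ measurable S, (mu S < +oo)%E & forall x, ~ S x -> f x = 0]].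

Lemma tame_integrable f : tame f -> mu.-integrable setT (EFin \o f).
Proof.
move=> [mf [C fC] [S [mS Soo fS]]].
have := @measurable_bounded_integrable _ _ _ mu f S mS Soo
  (measurable_funS measurableT (@subsetT _ S) mf).
have bf : [bounded f x | x in S].
  exists C; split; first exact: num_real.
  by move=> x Cx y _; exact: le_trans (fC y) (ltW Cx).
move=> /(_ bf); rewrite integrable_mkcond//.
congr (_.-integrable _ _); apply/funext => x; rewrite /patch /=.
by case: ifPn => // /negP; rewrite inE => /fS ->.
Qed.

Lemma tameM f g : tame f -> measurable_fun setT g ->
  (exists C, forall x, `|g x| <= C) -> tame (fun x => f x * g x).
Proof.
move=> [mf [C fC] [S [mS Soo fS]]] mg [D gD]; split.
- exact: measurable_funM.
- exists (C * D) => x; rewrite normrM; apply: ler_pM => //.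
- by exists S; split => // x /fS ->; rewrite mul0r.
Qed.

Lemma tameD f g : tame f -> tame g -> tame (fun x => f x + g x).
Proof.
move=> [mf [C fC] [S [mS Soo fS]]] [mg [D gD] [S' [mS' S'oo gS']]]; split.
- exact: measurable_funD.
- by exists (C + D) => x; apply: (le_trans (ler_normD _ _)); exact: lerD.
- exists (S `|` S'); split; first exact: measurableU.
    apply: le_lt_trans (measureU2 _ _ _) _ => //; exact: lte_add_pinfty.
  by move=> x /not_orP[/fS -> /gS' ->]; rewrite addr0.
Qed.

Lemma tameZ c f : tame f -> tame (fun x => c * f x).
Proof.
move=> tf; under eq_fun do rewrite mulrC; apply: tameM => //.
by exists `|c|.
Qed.

Lemma tameB f g : tame f -> tame g -> tame (fun x => f x - g x).
Proof.
move=> tf /(@tameZ (-1)) tg; under eq_fun do rewrite -mulN1r.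
exact: tameD.
Qed.

Lemma tame_norm f : tame f -> tame (fun x => `|f x|).
Proof.
move=> [mf [C fC] [S [mS Soo fS]]]; split.
- exact: measurableT_comp.
- by exists C => x; rewrite normr_id.
- by exists S; split => // x /fS ->; rewrite normr0.
Qed.

Lemma tame0 : tame (fun=> 0).
Proof.
split => //; first by exists 0 => x; rewrite normr0.
by exists set0; rewrite measure0.
Qed.

Lemma tame_sum (I : Type) (r : seq I) (F : I -> T -> R) :
  (forall i, tame (F i)) -> tame (fun x => \sum_(i <- r) F i x).
Proof.
move=> tF; elim: r => [|i r IH].
  by under eq_fun do rewrite big_nil; exact: tame0.
by under eq_fun do rewrite big_cons; exact: tameD.
Qed.

Lemma tame_indic A : measurable A -> (mu A < +oo)%E -> tame (\1_A : T -> R).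
Proof.
move=> mA Aoo; split; first exact: measurable_indic.
  by exists 1 => x; rewrite indicE ger0_norm// lern1 leq_b1.
by exists A; split => // x Ax; rewrite indicE memNset.
Qed.

Lemma Rintegral_sum (I : Type) (r : seq I) (F : I -> T -> R) :
  (forall i, tame (F i)) ->
  \int[mu]_x (\sum_(i <- r) F i x) = \sum_(i <- r) \int[mu]_x F i x.
Proof.
move=> tF; elim: r => [|i r IH].
  rewrite big_nil; under eq_Rintegral do rewrite big_nil.
  by rewrite Rintegral_cst// mul0r.
rewrite big_cons -IH -RintegralD//.
- by apply: eq_Rintegral => x _; rewrite big_cons.
- exact/tame_integrable/tF.
- exact/tame_integrable/tame_sum.
Qed.

Lemma Rintegral_indic A : measurable A -> \int[mu]_x \1_A x = fine (mu A).
Proof. by move=> mA; rewrite /Rintegral integral_indic// setIT. Qed.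

Lemma normr_Rintegral_le f g : tame f -> tame g ->
  (forall x, `|f x| <= g x) -> `|\int[mu]_x f x| <= \int[mu]_x g x.
Proof.
move=> tf tg fg.
apply: (le_trans (le_normr_Rintegral measurableT (tame_integrable tf))).
apply: le_Rintegral => //; apply: tame_integrable => //.
exact: tame_norm.
Qed.

End tame.

(** * Integration on the line *)

Section line.
Context {R : realType}.
Notation mu := (@lebesgue_measure R).
Implicit Types (t a : R) (f : R -> R) (n : nat).

(** Real powers are measurable on the whole line, singularity at 0 included; the
square removes the restriction to nonnegative arguments. *)
Lemma measurable_inv : measurable_fun setT (@GRing.inv R).
Proof.
have -> : @GRing.inv R = fun x => x * (x ^+ 2) `^ (-1).
  apply/funext => x; rewrite powR_inv1 ?sqr_ge0// expr2.
  by have [->|x0] := eqVneq x 0; [rewrite mul0r invr0|rewrite invfM mulVKf].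
apply: measurable_funM => //; apply: (measurableT_comp (@measurable_powR R (-1))).
exact: measurable_funX.
Qed.

Lemma measurable_shift a :
  measurable_fun setT (fun t : measurableTypeR R => t + a : measurableTypeR R).
Proof. exact: measurable_funD. Qed.

Lemma lebesgue_measure_shift a (A : set (measurableTypeR R)) : measurable A ->
  mu [set t | A (t + a)] = mu A.
Proof.
move=> mA; pose m := isMeasurableFun.Build _ _ _ _ _ (measurable_shift a).
pose s : {mfun measurableTypeR R >-> measurableTypeR R} :=
  HB.pack (fun t : measurableTypeR R => t + a) m.
apply/esym/(@lebesgue_measure_unique _
  (pushforward mu s : {measure set (measurableTypeR R) -> \bar R})) => //.
move=> _ [[b c] _ <-] /=; rewrite /pushforward.
have -> : s @^-1` `]b, c] = `]b - a, c - a]%classic.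
  by apply/seteqP; split => t /=; rewrite !in_itv/= ltrBlDr lerBrDr.
rewrite !lebesgue_measure_itv/= !lte_fin ltrD2r.
by case: ifPn => // _; rewrite -!EFinB; congr EFin; ring.
Qed.

Lemma tame_shift a f : tame mu f -> tame mu (fun t => f (t + a)).
Proof.
move=> [mf [C fC] [S [mS Soo fS]]]; split.
- exact: (measurableT_comp mf (measurable_shift a)).
- by exists C.
- exists [set t | S (t + a)]; split; last by move=> t /fS.
    by rewrite -[X in measurable X]setTI; exact: measurable_shift.
  by rewrite [X in (X < _)%E](lebesgue_measure_shift a mS).
Qed.

Lemma Rintegral_shift a f : tame mu f -> \int[mu]_t f (t + a) = \int[mu]_t f t.
Proof.
move=> tf; rewrite /Rintegral; congr fine.
rewrite -(@integral_pushforward _ _ _ _ _ _ (measurable_shift a) mu setT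
  (EFin \o f))//.
- have ms := @measurable_shift a.
  apply: eq_measure_integral => A mA _; exact: (lebesgue_measure_shift a mA).
- by apply/measurable_EFinP; case: tf.
- exact: (tame_integrable (tame_shift a tf)).
Qed.

Lemma lebesgue_measure_bounded_itv (b c : bool) x y : x <= y ->
  mu [set` Interval (BSide b x) (BSide c y)] = (y - x)%:E.
Proof.
move=> xy; rewrite lebesgue_measure_itv/= lte_fin.
by move: xy; rewrite le_eqVlt => /predU1P[->|->//]; rewrite ltxx subrr.
Qed.

Lemma tame_itv (b c : bool) x y : x <= y ->
  tame mu (\1_[set` Interval (BSide b x) (BSide c y)]).
Proof.
move=> xy; apply: tame_indic => //.
by rewrite [X in (X < _)%E](lebesgue_measure_bounded_itv b c xy) ltry.
Qed.

Lemma Rintegral_itv (b c : bool) x y : x <= y ->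
  \int[mu]_t \1_[set` Interval (BSide b x) (BSide c y)] t = y - x.
Proof.
by move=> xy; rewrite Rintegral_indic// [X in fine X](lebesgue_measure_bounded_itv b c xy).
Qed.

(** Half-open, so that the integer translates partition the line. *)
Definition period : set R := [set` `]- 2^-1, 2^-1]].

Lemma Rintegral_cos_period (j n : nat) :
  \int[mu]_t (\1_period t * cos (2 * pi * (j%:R - n%:R) * t)) = (j == n)%:R.
Proof.
have [->|jn] := eqVneq j n.
  under eq_Rintegral do rewrite subrr mulr0 mul0r cos0 mulr1.
  by rewrite Rintegral_itv /= ?mulr1n; lra.
set a := 2 * pi * _.
have a0 : a != 0.
  apply: mulf_neq0; first by rewrite gt_eqF// mulr_gt0// pi_gt0.
  by rewrite subr_eq0 eqr_nat.
have -> : \int[mu]_t (\1_period t * cos (a * t)) =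
    \int[mu]_(t in `]-2^-1, 2^-1]) cos (a * t).
  rewrite [RHS]Rintegral_mkcond; apply: eq_Rintegral => t _.
  by rewrite patchE indicE; case: ifP => _; rewrite ?mul1r ?mul0r.
have cont : continuous (fun t => cos (a * t)).
  move=> t; apply: (continuous_comp (f := fun t => a * t)).
    exact: mulrl_continuous.
  exact: continuous_cos.
have dF t : is_derive t (1 : R) (fun t => a^-1 * sin (a * t)) (cos (a * t)).
  have da : is_derive t (1 : R) (fun t => a * t) a.
    by apply: is_derive_eq; rewrite /GRing.scale/= mulr1.
  apply: is_derive_eq; rewrite /GRing.scale/=.
  by rewrite mulrCA mulVf// mulr1.
have cF : continuous (fun t => a^-1 * sin (a * t)).
  by move=> t; apply: differentiable_continuous; apply/derivable1_diffP; apply: ex_derive.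
have h : - 2^-1 < 2^-1 :> R by lra.
rewrite Rintegral_itv_obnd_cbnd; last first.
  apply: integrableS (continuous_compact_integrable
    (@segment_compact R (- 2^-1) 2^-1) _) => //.
    by apply: subset_itvr; rewrite bnd_simp.
  exact: continuous_subspaceT.
rewrite /Rintegral (@continuous_FTC2 _ _ (fun t => a^-1 * sin (a * t)))//.
- rewrite -EFinB /=.
  have -> : a * 2^-1 = a * - 2^-1 + 2 * pi * (j%:R - n%:R) by rewrite /a; field.
  by rewrite sin_shift_int subrr.
- exact: continuous_subspaceT.
- split.
  + by move=> x _; apply: ex_derive.
  + exact/cvg_at_right_filter/cF.
  + exact/cvg_at_left_filter/cF.
- by move=> x _; rewrite derive1E derive_val.
Qed.

End line.

(** * Dirichlet integrals of Lipschitz functions on the line *)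

Section one_dim.
Context {R : realType}.
Notation mu := (@lebesgue_measure R).
Implicit Types (t a K : R) (f w G : R -> R) (n : nat).

Lemma bounded_dirichlet n : exists C, forall t : R, `|dirichlet n t| <= C.
Proof. by exists n.*2.+1%:R => t; exact: dirichlet_le. Qed.

Lemma measurable_sinZ a : measurable_fun setT (fun t : R => sin (a * t)).
Proof. exact: (measurableT_comp measurable_sin). Qed.

Definition lipschitz_by K w := forall s t, `|w s - w t| <= K * `|s - t|.

Lemma lipschitz_by_ge0 K w : lipschitz_by K w -> 0 <= K.
Proof.
by move=> /(_ 1 0); rewrite subr0 normr1 mulr1; apply: le_trans.
Qed.

(** A quantitative Riemann-Lebesgue lemma: a shift by r, half a period of the
sine, changes its sign, so the integral is half that of
(G(t) - G(t + r)) sin(pi t / r). *)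
Lemma Rintegral_sin_le G (r : R) : 0 < r -> tame mu G ->
  `|\int[mu]_t (G t * sin (pi * r^-1 * t))| <= 2^-1 * \int[mu]_t `|G t - G (t + r)|.
Proof.
move=> r0 tG; set A := \int[mu]_t _; pose s t := sin (pi * r^-1 * t).
have bs : exists C, forall t, `|s t| <= C by exists 1 => t; exact: sin_max.
have ms : measurable_fun setT s := measurable_sinZ _.
have tGs : tame mu (fun t => G t * s t) := tameM tG ms bs.
have tG' := tame_shift r tG.
have tGs' : tame mu (fun t => G (t + r) * s t) := tameM tG' ms bs.
have AE : A = - \int[mu]_t (G (t + r) * s t).
  rewrite -mulN1r -RintegralZl//; last exact: tame_integrable.
  rewrite /A -(Rintegral_shift r tGs); apply: eq_Rintegral => t _.
  by rewrite /s mulrDr mulfVK ?gt_eqF// sinDpi mulrN mulN1r.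
have -> : A = 2^-1 * \int[mu]_t ((G t - G (t + r)) * s t).
  under eq_Rintegral do rewrite mulrBl.
  rewrite RintegralB//; [|exact: tame_integrable..].
  by rewrite -/A -[X in _ - X]opprK -AE; field.
rewrite normrM ger0_norm ?invr_ge0// ler_pM2l ?invr_gt0//.
apply: normr_Rintegral_le.
- by apply: tameM => //; exact: tameB.
- exact/tame_norm/tameB.
- by move=> t; rewrite normrM ler_piMr// sin_max.
Qed.

Section local.
Variables (w : R -> R) (K : R).
Hypotheses (mw : measurable_fun setT w) (wK : lipschitz_by K w).

Let K0 : 0 <= K := lipschitz_by_ge0 wK.

(** By [sin_dirichlet], G(t) sin(pi (2n+1) t) is (w(t) - w(0)) times the kernel.
At t = 0 the quotient is 0 by the convention on the inverse of 0. *)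
Let G t := \1_period t * ((w t - w 0) * (sin (pi * t))^-1).

Let in_period t : t \in (period : set R) -> `|t| <= 2^-1.
Proof. by rewrite inE /period /= in_itv/= ler_norml => /andP[/ltW -> ->]. Qed.

Let sin_neq0 t : `|t| <= 2^-1 -> t != 0 -> sin (pi * t) != 0.
Proof.
by move=> t2 t0; rewrite -normr_gt0 (lt_le_trans _ (norm_le_sin_pi t2))// normr_gt0.
Qed.

Let GK t : `|G t| <= K.
Proof.
rewrite /G indicE; case: (boolP (t \in _)) => [/in_period t2|_]; last first.
  by rewrite mul0r normr0.
rewrite mul1r normrM; have [->|t0] := eqVneq t 0.
  by rewrite subrr normr0 mul0r.
rewrite normfV ler_pdivrMr ?normr_gt0 ?sin_neq0//.
apply: (le_trans (wK _ _)); rewrite subr0 ler_wpM2l//.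
exact: norm_le_sin_pi.
Qed.

Let tG : tame mu G.
Proof.
split.
- apply: measurable_funM; first by apply: measurable_indic; exact: measurable_itv.
  apply: measurable_funM; first exact: measurable_funB.
  exact: (measurableT_comp measurable_inv (measurable_sinZ _)).
- by exists K.
- exists period; split; first exact: measurable_itv; last first.
    by move=> t pt; rewrite /G indicE memNset// mul0r.
  by rewrite [X in (X < _)%E]lebesgue_measure_bounded_itv ?ltry//; lra.
Qed.

(** G is Lipschitz away from 0 only: the constant grows like 1 / |s|. *)
Let G_lip t s : `|t| <= 2^-1 -> `|s| <= 2^-1 -> t != 0 -> s != 0 ->
  `|(w t - w 0) * (sin (pi * t))^-1 - (w s - w 0) * (sin (pi * s))^-1|
    <= K * (1 + pi) * `|t - s| / `|s|.
Proof.
move=> t2 s2 t0 s0; have St := sin_neq0 t2 t0; have Ss := sin_neq0 s2 s0.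
have -> : (w t - w 0) * (sin (pi * t))^-1 - (w s - w 0) * (sin (pi * s))^-1 =
  (w t - w s) / sin (pi * s) + (w t - w 0) / sin (pi * t) *
    ((sin (pi * s) - sin (pi * t)) / sin (pi * s)) by field; rewrite St Ss.
have ss : `|(sin (pi * s))^-1| <= `|s|^-1.
  rewrite normfV lef_pV2 ?posrE ?normr_gt0//; exact: norm_le_sin_pi.
have h1 : `|(w t - w s) / sin (pi * s)| <= K * `|t - s| / `|s|.
  by rewrite normrM; apply: ler_pM.
have h2 : `|(w t - w 0) / sin (pi * t)| <= K.
  rewrite normrM normfV ler_pdivrMr ?normr_gt0//.
  by apply: (le_trans (wK _ _)); rewrite subr0 ler_wpM2l// norm_le_sin_pi.
have h3 : `|(sin (pi * s) - sin (pi * t)) / sin (pi * s)| <= pi * `|t - s| / `|s|.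
  rewrite normrM; apply: ler_pM => //.
  apply: (le_trans (sin_lipschitz _ _)).
  by rewrite -mulrBr normrM distrC (ger0_norm (pi_ge0 R)).
apply: (le_trans (ler_normD _ _)); rewrite (normrM (_ / _)).
have -> : K * (1 + pi) * `|t - s| / `|s| =
   K * `|t - s| / `|s| + K * (pi * `|t - s| / `|s|) by ring.
by apply: lerD => //; apply: ler_pM.
Qed.

(** By [Rintegral_sin_le] with r = 1 / (2n+1), the integral is controlled by the
mean of |G(t) - G(t + r)|.  Where |t + r| exceeds rho this difference is at most
a multiple of K r / rho; elsewhere it is at most 2 K, on a set of measure 2 rho;
the two ends of the period, where only one of t and t + r lies inside, have
measure r each.  The choice rho = sqrt r balances these terms. *)
Lemma dirichlet_local n :
  `|\int[mu]_t (\1_period t * ((w t - w 0) * dirichlet n t))| <=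
  6 * K * (Num.sqrt n.*2.+1%:R)^-1.
Proof.
pose r : R := n.*2.+1%:R^-1; pose rho : R := (Num.sqrt n.*2.+1%:R)^-1.
have N0 : 0 < n.*2.+1%:R :> R by rewrite ltr0n.
have r0 : 0 < r by rewrite invr_gt0.
have rho0 : 0 < rho by rewrite invr_gt0 sqrtr_gt0.
have rho2 : rho * rho = r by rewrite -invfM -expr2 sqr_sqrtr// ltW.
have rho1 : rho <= 1.
  rewrite invf_le1 ?sqrtr_gt0// -[X in X <= _]sqrtr1.
  by rewrite ler_wsqrtr// ler1n.
have rrho : r <= rho by rewrite -rho2 ler_piMr// ltW.
have -> : \int[mu]_t (\1_period t * ((w t - w 0) * dirichlet n t)) =
    \int[mu]_t (G t * sin (pi * r^-1 * t)).
  apply: eq_Rintegral => t _; rewrite /G invrK -sin_dirichlet indicE.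
  case: (boolP (t \in _)) => [/in_period t2|_]; last by rewrite !mul0r.
  have [->|t0] := eqVneq t 0; first by rewrite subrr !(mul0r, mulr0).
  by rewrite !mul1r mulrA mulfVK// sin_neq0.
apply: (le_trans (Rintegral_sin_le r0 tG)).
(* A majorant of |G(t) - G(t + r)|: the four terms are, in this order, for t + r
away from 0, for t + r close to 0, and for the left and right ends. *)
pose M t := K * (1 + pi) * rho * \1_`[- 2^-1, 2^-1] t +
  (2 * K * \1_`[- rho - r, rho - r] t + (K * \1_`[- 2^-1 - r, - 2^-1] t +
     K * \1_`[2^-1 - r, 2^-1] t)).
have t1 : tame mu (\1_`[- 2^-1, 2^-1]) by apply: tame_itv; lra.
have t2 : tame mu (\1_`[- rho - r, rho - r]) by apply: tame_itv; lra.
have t3 : tame mu (\1_`[- 2^-1 - r, - 2^-1]) by apply: tame_itv; lra.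
have t4 : tame mu (\1_`[2^-1 - r, 2^-1]) by apply: tame_itv; lra.
have tM : tame mu M by do ?[apply: tameD]; exact: tameZ.
have iM : \int[mu]_t M t <= 12 * K * rho.
  rewrite !RintegralD//; try by apply/tame_integrable; do ?[apply: tameD]; exact: tameZ.
  rewrite !RintegralZl//; try exact: tame_integrable.
  rewrite !Rintegral_itv; [|lra..].
  have pi4 : pi <= 4 :> R by have := pihalf_lt2 R; lra.
  have h1 : K * rho * pi <= K * rho * 4 by rewrite ler_wpM2l// mulr_ge0// ltW.
  have h2 : K * r <= K * rho by rewrite ler_wpM2l.
  have h3 : 0 <= K * rho by rewrite mulr_ge0// ltW.
  lra.
rewrite -/rho.
suff : \int[mu]_t `|G t - G (t + r)| <= \int[mu]_t M t by lra.
apply: le_Rintegral => //; try apply: tame_integrable => //.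
  exact/tame_norm/tameB/tame_shift.
move=> t _; have pi0 := pi_gt0 R; rewrite /M !indicE.
have Krho : 0 <= K * (1 + pi) * rho.
  by apply: mulr_ge0; [apply: mulr_ge0 => //; rewrite addr_ge0// ltW|exact: ltW].
have K20 : 0 <= 2 * K by rewrite mulr_ge0.
have b0 (b : bool) : 0 <= b%:R :> R by case: b.
have z1 := mulr_ge0 Krho (b0 (t \in `[- 2^-1, 2^-1]%classic)).
have z2 := mulr_ge0 K20 (b0 (t \in `[- rho - r, rho - r]%classic)).
have z3 := mulr_ge0 K0 (b0 (t \in `[- 2^-1 - r, - 2^-1]%classic)).
have z4 := mulr_ge0 K0 (b0 (t \in `[2^-1 - r, 2^-1]%classic)).
have G0 s : s \notin period -> G s = 0 by move=> sp; rewrite /G indicE (negbTE sp) mul0r.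
have [tp|tp] := boolP (t \in period); have [sp|sp] := boolP (t + r \in period).
- have := in_period tp; have := in_period sp => sp2 tp2.
  have [tr|tr] := leP `|t + r| rho.
    have E2 : t \in `[- rho - r, rho - r]%classic.
      by rewrite inE /= in_itv /=; move: tr; rewrite ler_norml; lra.
    have : `|G t - G (t + r)| <= K + K by apply: (le_trans (ler_normB _ _)); exact: lerD.
    rewrite E2 mulr1 in z2 *; lra.
  have tr0 : t + r != 0 by rewrite -normr_gt0 (lt_trans rho0).
  (* if t = 0, then |t + r| = r <= rho *)
  have t0 : t != 0.
    by apply: contraTneq tr => ->; rewrite add0r gtr0_norm// -leNgt.
  have E1 : t \in `[- 2^-1, 2^-1]%classic by rewrite inE /= in_itv /= -ler_norml.
  have : `|G t - G (t + r)| <= K * (1 + pi) * rho.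
    rewrite /G !indicE tp sp !mul1r (le_trans (G_lip tp2 sp2 t0 tr0))//.
    have -> : t - (t + r) = - r by ring.
    rewrite normrN (gtr0_norm r0) -mulrA ler_wpM2l//.
      by rewrite mulr_ge0// addr_ge0// ltW.
    by rewrite ler_pdivrMr ?normr_gt0// -[X in X <= _]rho2 ler_pM2l// ltW.
  rewrite E1 mulr1 in z1 *; lra.
- have E4 : t \in `[2^-1 - r, 2^-1]%classic.
    move: tp sp; rewrite /period !inE /= notin_setE /= !in_itv/=; lra.
  rewrite (G0 _ sp) subr0; have := GK t; rewrite E4 mulr1 in z4 *; lra.
- have E3 : t \in `[- 2^-1 - r, - 2^-1]%classic.
    move: tp sp; rewrite /period !inE /= notin_setE /= !in_itv/=; lra.
  rewrite (G0 _ tp) sub0r normrN; have := GK (t + r); rewrite E3 mulr1 in z3 *; lra.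
- rewrite (G0 _ tp) (G0 _ sp) subrr normr0; lra.
Qed.

End local.

Implicit Types v : R -> R.

(** By continuity, the function also vanishes at the two end points. *)
Lemma lipschitz_edge K v : lipschitz_by K v ->
  (forall s, 2^-1 < `|s| -> v s = 0) -> forall s, 2^-1 <= `|s| -> v s = 0.
Proof.
move=> vK v0 s s2; have K0 := lipschitz_by_ge0 vK.
apply/eqP; rewrite -normr_le0; apply/ler_addgt0Pr => e e0; rewrite add0r.
have [e' [e'0 e'E]] : exists e', 0 < e' /\ K * e' <= e.
  exists (e / (K + 1)); split; first by rewrite divr_gt0// ltr_wpDl.
  by rewrite mulrA ler_pdivrMr ?ltr_wpDl//; lra.
have [s0|s0] := leP 0 s.
  have := vK s (s + e'); rewrite [v (s + e')]v0; last first.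
    by move: s2; rewrite !ger0_norm//; lra.
  have -> : s - (s + e') = - e' by ring.
  by rewrite subr0 normrN (gtr0_norm e'0) => /le_trans; apply.
have := vK s (s - e'); rewrite [v (s - e')]v0; last first.
  by move: s2; rewrite !ltr0_norm//; lra.
have -> : s - (s - e') = e' by ring.
by rewrite subr0 (gtr0_norm e'0) => /le_trans; apply.
Qed.

Lemma Rintegral_dirichlet n : \int[mu]_t (\1_period t * dirichlet n t) = 1.
Proof.
under eq_Rintegral do rewrite /dirichlet mulr_sumr.
have jn : (n < n.*2.+1)%N by rewrite ltnS -addnn leq_addr.
rewrite Rintegral_sum; last first.
  move=> j; apply: tameM; first by apply: tame_itv; lra.
    by apply: (measurableT_comp measurable_cos); exact: measurable_funM.
  by exists 1 => t; exact: cos_max.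
rewrite (bigD1 (Ordinal jn))//= Rintegral_cos_period eqxx big1 ?addr0// => j jn'.
by rewrite Rintegral_cos_period (_ : _ == _ = false)//; apply/negbTE.
Qed.

Lemma period_partition t : `|t| <= 1 ->
  \1_period t + \1_period (t - 1) + \1_period (t + 1) = 1 :> R.
Proof.
rewrite ler_norml => /andP[t1 t2].
rewrite !indicE.
have E x : (x \in (period : set R)) = (- 2^-1 < x <= 2^-1).
  by apply/idP/idP; rewrite inE /period /= in_itv.
rewrite !E.
have [h1|h1] := boolP (- 2^-1 < t <= 2^-1).
  have /negbTE -> : ~~ (- 2^-1 < t - 1 <= 2^-1) by lra.
  have /negbTE -> : ~~ (- 2^-1 < t + 1 <= 2^-1) by lra.
  by rewrite !addr0.
have [h2|h2] := boolP (- 2^-1 < t - 1 <= 2^-1).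
  have /negbTE -> : ~~ (- 2^-1 < t + 1 <= 2^-1) by lra.
  by rewrite addr0 add0r.
have -> : - 2^-1 < t + 1 <= 2^-1 by lra.
by rewrite !add0r.
Qed.

(** After the substitution s = t + a, the integrand lives on [-1, 1].  Cutting
this interval with the period and its translates by -1 and 1, and using the
periodicity of the kernel, folds it into the integral over one period of
w(t) = v(t + a) + v(t + 1 + a) + v(t - 1 + a).  This w is Lipschitz with constant
3 K and w(0) = v(a), because v vanishes at a + 1 and a - 1; since the kernel has
mean 1, [dirichlet_local] applies to w. *)
Lemma dirichlet_approx v K n a : measurable_fun setT v -> lipschitz_by K v ->
  (forall s, 2^-1 < `|s| -> v s = 0) -> `|a| <= 2^-1 ->
  `|(\int[mu]_s (v s * dirichlet n (s - a))) - v a| <=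
  18 * K * (Num.sqrt n.*2.+1%:R)^-1.
Proof.
move=> mv vK v0 a2; have K0 := lipschitz_by_ge0 vK.
have v0' := lipschitz_edge vK v0.
have tv : tame mu v.
  split => //.
    exists (K * 2) => s; have [s2|s2] := ltP 2^-1 `|s|.
      by rewrite v0// normr0 mulr_ge0.
    have := vK s 1; rewrite [v 1]v0 ?subr0 => [/le_trans|]; last first.
      by rewrite normr1; lra.
    apply; rewrite ler_wpM2l// (le_trans (ler_normB _ _))// normr1; lra.
  exists [set` `[- 2^-1, 2^-1]]; split; first exact: measurable_itv.
    by rewrite [X in (X < _)%E]lebesgue_measure_bounded_itv ?ltry//; lra.
  move=> s /negP; rewrite /= in_itv/= -ler_norml -ltNge; exact: v0.
pose w t := v (t + a) + v (t + (1 + a)) + v (t + (-1 + a)).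
have tw : tame mu w by apply: tameD; [apply: tameD|]; exact: tame_shift.
have wK : lipschitz_by (3 * K) w.
  move=> s t.
  have -> : w s - w t = (v (s + a) - v (t + a)) +
     (v (s + (1 + a)) - v (t + (1 + a))) + (v (s + (-1 + a)) - v (t + (-1 + a))).
    by rewrite /w; ring.
  have H b : `|v (s + b) - v (t + b)| <= K * `|s - t|.
    by have -> : s - t = s + b - (t + b) by ring.
  apply: (le_trans (ler_normD _ _)).
  have := ler_normD (v (s + a) - v (t + a)) (v (s + (1 + a)) - v (t + (1 + a))).
  have := H a; have := H (1 + a); have := H (-1 + a); lra.
have w0 : w 0 = v a.
  move: a2; rewrite /w !add0r ler_norml => /andP[a1 a2].
  rewrite [v (1 + a)]v0' 1?[v (-1 + a)]v0' ?addr0//.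
    by rewrite ler0_norm; lra.
  by rewrite ger0_norm; lra.
have bD := bounded_dirichlet n; have mD := @measurable_dirichlet R n.
pose F t := v (t + a) * dirichlet n t.
have tF : tame mu F by apply: tameM => //; exact: tame_shift.
have tP : tame mu (\1_period) by apply: tame_itv; lra.
have tFP b : tame mu (fun t => F t * \1_period (t + b)).
  apply: tameM => //; first by case: (tame_shift b tP).
  by exists 1 => t; rewrite indicE ger0_norm// lern1 leq_b1.
have -> : \int[mu]_s (v s * dirichlet n (s - a)) = \int[mu]_t F t.
  rewrite -(@Rintegral_shift _ a).
    by apply: eq_Rintegral => t _; rewrite /F addrK.
  apply: tameM => //.
    by apply: (measurableT_comp mD); exact: measurable_funB.
  by case: bD => C CP; exists C.
have -> : \int[mu]_t F t = \int[mu]_t (w t * dirichlet n t * \1_period t).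
  transitivity (\int[mu]_t (F t * \1_period (t + 0) +
     (F t * \1_period (t + -1) + F t * \1_period (t + 1)))).
    apply: eq_Rintegral => t _; rewrite -!mulrDr addrA addr0.
    have [t1|t1] := leP `|t| 1; first by rewrite period_partition// mulr1.
    rewrite /F v0 ?mul0r//.
    have := ler_normB (t + a) a; rewrite addrK; lra.
  rewrite !RintegralD//; try by apply: tame_integrable => //; apply: tameD.
  rewrite -(Rintegral_shift 1 (tFP (-1))) -(Rintegral_shift (-1) (tFP 1)).
  have s1 := tame_shift 1 (tFP (-1)); have s2 := tame_shift (-1) (tFP 1).
  rewrite -!RintegralD//; try by apply: tame_integrable => //; exact: tameD.
  apply: eq_Rintegral => t _; rewrite /F dirichletD1 dirichletB1 subrK addrK addr0 /w.
  by rewrite !(addrA t); ring.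
have -> : (\int[mu]_t (w t * dirichlet n t * \1_period t)) - v a =
    \int[mu]_t (\1_period t * ((w t - w 0) * dirichlet n t)).
  have twP : tame mu (fun t => w t * dirichlet n t * \1_period t).
    apply: tameM; [exact: tameM|by case: tP|by case: tP].
  have tDP : tame mu (fun t => \1_period t * dirichlet n t) by exact: tameM.
  have -> : v a = \int[mu]_t (w 0 * (\1_period t * dirichlet n t)).
    rewrite RintegralZl//; last exact: tame_integrable.
    by rewrite Rintegral_dirichlet mulr1.
  rewrite -RintegralB//; [|exact: tame_integrable|].
    by apply: eq_Rintegral => t _; ring.
  by apply: tame_integrable; exact: tameZ.
have -> : 18 * K = 6 * (3 * K) by ring.
by apply: dirichlet_local => //; case: tw.
Qed.

Definition harmonic_sum (m : nat) : R := \sum_(k < m) k.+1%:R^-1.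

Let c (k : nat) t : R := \1_`[- k.+1%:R^-1, k.+1%:R^-1] t.

Let cE k t : c k t = (`|t| <= k.+1%:R^-1)%R%:R.
Proof.
by rewrite /c indicE; congr (nat_of_bool _)%:R; apply/idP/idP;
  rewrite inE/= in_itv/= ler_norml.
Qed.

Let c_ge0 k t : 0 <= c k t.
Proof. by rewrite cE. Qed.

(** For |t| <= 1, the minimum of m and 1 / |t| is at most twice the number of
indices k < m with |t| <= 1 / (k + 1). *)
Let layer_cake (m : nat) t x : `|t| <= 1 -> 0 <= x <= m%:R -> `|t| * x <= 1 ->
  x <= 2 * \sum_(k < m) c k t.
Proof.
move=> t1; elim: m x => [|m IH] x /andP[x0 xm] tx.
  by rewrite big_ord0 mulr0.
have full p : `|t| <= p%:R^-1 -> \sum_(k < p) c k t = p%:R.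
  case: p => [|p] tp; first by rewrite big_ord0.
  rewrite (eq_bigr (fun=> 1)) ?sumr_const ?card_ord// => k _; rewrite cE (le_trans tp)//.
  by rewrite lef_pV2 ?posrE// ler_nat.
have [tm|tm] := leP `|t| m.+1%:R^-1.
  rewrite full//; lra.
rewrite big_ord_recr/=; have cm := c_ge0 m t.
have [xm'|xm'] := leP x m%:R.
  have := IH x; rewrite x0 xm' => /(_ erefl tx); lra.
rewrite full.
  case: m => [|m] in tm xm xm' cm IH *.
    by rewrite invr1 in tm; have := le_lt_trans t1 tm; rewrite ltxx.
  move: xm; rewrite -natr1 -[m.+1%:R]natr1; have := ler0n R m; lra.
have x0' : 0 < x by rewrite (le_lt_trans _ xm').
case: m => [|m] in tm xm xm' cm IH *.
  by rewrite invr1 in tm; have := le_lt_trans t1 tm; rewrite ltxx.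
apply: (@le_trans _ _ x^-1); first by rewrite -[X in _ <= X]mul1r ler_pdivlMr.
by rewrite lef_pV2 ?posrE// ltW.
Qed.

(** Logarithmic growth of the Lebesgue constants.  As s - a ranges over [-1, 1],
the majorant of [layer_cake] is repeated at -1, 0 and 1; each k then contributes
2 * 3 intervals of length 2 / (k + 1), whence the factor 12. *)
Lemma Rintegral_normr_dirichlet n a : `|a| <= 2^-1 ->
  \int[mu]_s (\1_`[- 2^-1, 2^-1] s * `|dirichlet n (s - a)|) <=
  12 * harmonic_sum n.*2.+1.
Proof.
move=> a2; pose C (k : 'I_n.*2.+1) s :=
  2 * (c k (s - a) + (c k (s + (- a - 1)) + c k (s + (- a + 1)))).
have tc k b : tame mu (fun s => c k (s + b)).
  have k0 : 0 <= k.+1%:R^-1 :> R by rewrite invr_ge0.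
  apply: tame_shift; apply: tame_itv; by rewrite (le_trans _ k0)// oppr_le0 k0.
have tC k : tame mu (C k) by apply/tameZ/tameD => //; exact: tameD.
have tS := tame_sum (index_enum 'I_n.*2.+1) tC.
have iC k : \int[mu]_s C k s = 12 * k.+1%:R^-1.
  have k0 : 0 <= k.+1%:R^-1 :> R by rewrite invr_ge0.
  have ic b : \int[mu]_s c k (s + b) = k.+1%:R^-1 *+ 2.
    have k1 : - k.+1%:R^-1 <= k.+1%:R^-1 :> R by rewrite (le_trans _ k0)// oppr_le0.
    rewrite Rintegral_shift; last exact: tame_itv.
    by rewrite Rintegral_itv// opprK mulr2n.
  rewrite /C RintegralZl//; last by apply/tame_integrable/tameD => //; exact: tameD.
  rewrite !RintegralD//; try by apply/tame_integrable => //; apply: tameD.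
  by rewrite !ic !mulr2n; ring.
have -> : 12 * harmonic_sum n.*2.+1 = \int[mu]_s \sum_(k < n.*2.+1) C k s.
  by rewrite Rintegral_sum// /harmonic_sum mulr_sumr; apply: eq_bigr => k _.
apply: le_Rintegral => //.
- apply: tame_integrable; apply: tameM; first by apply: tame_itv; lra.
    apply: measurableT_comp => //; apply: (measurableT_comp (measurable_dirichlet n)).
    exact: measurable_funD.
  by have [B HB] := bounded_dirichlet n; exists B => s; rewrite normr_id.
- exact: tame_integrable.
move=> s _; rewrite -mulr_sumr !big_split/=.
have P b : 0 <= \sum_(k < n.*2.+1) c k (s + b) by apply: sumr_ge0 => k _; exact: c_ge0.
have P1 := P (- a); have P2 := P (- a - 1); have P3 := P (- a + 1).
rewrite indicE; case: (boolP (s \in _)) => [|_]; last by rewrite mul0r; lra.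
rewrite inE/= in_itv/= mul1r => s2; move: a2; rewrite ler_norml => a2.
have L t : `|t| <= 2^-1 -> `|dirichlet n t| <= 2 * \sum_(k < n.*2.+1) c k t.
  move=> t2; apply: layer_cake; first by lra.
    by rewrite dirichlet_le normr_ge0.
  exact: dirichlet_le_inv.
have [h|h] := leP `|s - a| 2^-1; first by have := L _ h; lra.
have [h'|h'] := leP 0 (s - a).
  have := L (s + (- a - 1)); rewrite [s + _]addrA dirichletB1 => L'.
  have := L' _; have -> : (`|s - a - 1| <= 2^-1).
    by move: h; rewrite ger0_norm// => h; rewrite ler_norml; lra.
  move=> /(_ erefl); lra.
have := L (s + (- a + 1)); rewrite [s + _]addrA dirichletD1 => L'.
have := L' _; have -> : (`|s - a + 1| <= 2^-1).
  by move: h; rewrite ltr0_norm// => h; rewrite ler_norml; lra.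
move=> /(_ erefl); lra.
Qed.

End one_dim.

(** * Functions supported on the torus, and iterated integrals *)

Section cube.
Context {R : realType}.
Notation mu := (@lebesgue_measure R).
Notation lam d := (@lebesgue_cV R d).
Implicit Types (K : R) (n d : nat).

Lemma uncons_cVK d (z : 'cV[R]_d.+1) : cons_cV (uncons_cV z) = z.
Proof.
apply/colP => i; case: (unliftP ord0 i) => [k ->|->].
  by rewrite cons_cVS mxE.
by rewrite cons_cV0.
Qed.

Lemma torus_cons d (s : R) (y : 'cV[R]_d) :
  torus (cons_cV (s, y)) <-> `|s| <= 2^-1 /\ torus y.
Proof.
split=> [h|[h0 h] i].
  split; first by have := h ord0; rewrite cons_cV0.
  by move=> k; have := h (lift ord0 k); rewrite cons_cVS.
by case: (unliftP ord0 i) => [k ->|->]; rewrite ?cons_cVS ?cons_cV0//; exact: h.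
Qed.

Lemma torus_box d : @torus R d = [set x | forall i, [set` `[- 2^-1, 2^-1]] (x i ord0)].
Proof.
by apply/seteqP; split => x h i; have := h i; rewrite /= in_itv/= -ler_norml.
Qed.

Lemma measurable_box d (B : 'I_d -> set R) : (forall i, measurable (B i)) ->
  measurable [set x : 'cV[R]_d | forall i, B i (x i ord0)].
Proof.
move=> mB; rewrite (_ : [set _ | _] =
    \bigcap_(i in [set: 'I_d]) ((fun x : 'cV[R]_d => x i ord0) @^-1` B i)).
  apply: fin_bigcap_measurable => // i _.
  by rewrite -[X in measurable X]setTI; exact: measurable_coord.
by apply/seteqP; split => x /= h i => [_|]; exact: h.
Qed.

Lemma measurable_torus d : measurable (@torus R d).
Proof.
rewrite torus_box; apply: (@measurable_box d (fun=> `[- 2^-1, 2^-1]%classic)) => i.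
exact: measurable_itv.
Qed.

Lemma torus_fin d : (lam d (@torus R d) < +oo)%E.
Proof.
rewrite torus_box (@lebesgue_cV_box R d (fun=> `[- 2^-1, 2^-1]%classic)); last first.
  by move=> i; exact: measurable_itv.
rewrite big1 ?ltry// => i _; rewrite [LHS]lebesgue_measure_bounded_itv; last by lra.
by congr EFin; lra.
Qed.

(** Unlike [tame], this class passes to all sections of a function, not only to
almost all of them, so that it can be used in inductions on the dimension. *)
Definition torus_tame d (u : 'cV[R]_d -> R) := [/\ measurable_fun setT u,
  exists C, forall x, `|u x| <= C & forall x, ~ torus x -> u x = 0].

Lemma torus_tameP d (u : 'cV[R]_d -> R) : torus_tame u -> tame (lam d) u.
Proof.
move=> [mu bu u0]; split => //; exists torus; split => //.
  exact: measurable_torus.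
exact: torus_fin.
Qed.

Lemma torus_tameM d (u v : 'cV[R]_d -> R) : torus_tame u -> measurable_fun setT v ->
  (exists C, forall x, `|v x| <= C) -> torus_tame (fun x => u x * v x).
Proof.
move=> tu mv bv; have [mu bu _] := tameM (torus_tameP tu) mv bv; split => //.
by case: tu => _ _ u0 x /u0 ->; rewrite mul0r.
Qed.

Lemma torus_tameD d (u v : 'cV[R]_d -> R) : torus_tame u -> torus_tame v ->
  torus_tame (fun x => u x + v x).
Proof.
move=> tu tv; have [m b _] := tameD (torus_tameP tu) (torus_tameP tv); split => //.
by move: tu tv => [_ _ u0] [_ _ v0] x xT; rewrite u0// v0// addr0.
Qed.

Lemma torus_tameB d (u v : 'cV[R]_d -> R) : torus_tame u -> torus_tame v ->
  torus_tame (fun x => u x - v x).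
Proof.
move=> tu tv; have [m b _] := tameB (torus_tameP tu) (torus_tameP tv); split => //.
by move: tu tv => [_ _ u0] [_ _ v0] x xT; rewrite u0// v0// subr0.
Qed.

Let measurable_slice1 d (y : 'cV[R]_d) :
  measurable_fun setT (fun s : measurableTypeR R => cons_cV (s, y)).
Proof.
apply: (measurableT_comp (@measurable_cons_cV R d) (g := fun s => (s, y))).
exact: measurable_fun_pair.
Qed.

Lemma measurable_slice2 d (s : R) :
  measurable_fun setT (fun y : 'cV[R]_d => cons_cV (s, y)).
Proof.
apply: (measurableT_comp (@measurable_cons_cV R d) (g := fun y => (s, y))).
exact: measurable_fun_pair.
Qed.

Lemma torus_tame_slice1 d (u : 'cV[R]_d.+1 -> R) (y : 'cV[R]_d) :
  torus_tame u -> tame mu (fun s => u (cons_cV (s, y))).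
Proof.
move=> [m [C uC] u0]; split.
- exact: (measurableT_comp m (measurable_slice1 y)).
- by exists C.
- exists [set` `[- 2^-1, 2^-1]]; split; first exact: measurable_itv.
    by rewrite [X in (X < _)%E]lebesgue_measure_bounded_itv ?ltry//; lra.
  by move=> s /negP; rewrite /= in_itv/= -ler_norml => /negP s2; apply: u0 => /torus_cons[].
Qed.

Lemma torus_tame_slice2 d (u : 'cV[R]_d.+1 -> R) (s : R) :
  torus_tame u -> torus_tame (fun y => u (cons_cV (s, y))).
Proof.
move=> [m [C uC] u0]; split.
- exact: (measurableT_comp m (measurable_slice2 s)).
- by exists C.
- by move=> y yT; apply: u0 => /torus_cons[].
Qed.

Section iterate.
Variables (d : nat) (u : 'cV[R]_d.+1 -> R).
Hypothesis tu : torus_tame u.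

Let inner y := \int[mu]_s u (cons_cV (s, y)).

Let icons : (mu \x lam d)%E.-integrable setT (EFin \o u \o (@cons_cV R d)).
Proof.
pose S : set (measurableTypeR R * 'cV[R]_d) := [set` `[- 2^-1, 2^-1]] `*` torus.
have mS : measurable S.
  by apply: measurableX; [exact: measurable_itv|exact: measurable_torus].
have tuc : tame (mu \x lam d)%E (u \o (@cons_cV R d)).
  case: tu => m [C uC] u0; split.
  - by apply: (measurableT_comp (f := u)) => //; exact: measurable_cons_cV.
  - by exists C => p; exact: uC.
  - exists S; split => //.
      rewrite [X in (X < _)%E]product_measure1E//; last exact: measurable_torus.
      apply: lte_mul_pinfty; [exact: measure_ge0| |exact: torus_fin].
      by rewrite [X in X \is a _]lebesgue_measure_bounded_itv//; lra.
    move=> [s y] Ssy; apply: u0 => /torus_cons[s2 yT]; apply: Ssy.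
    by split => //=; rewrite in_itv/= -ler_norml.
exact: (tame_integrable tuc).
Qed.

Let inner_fin y : (\int[mu]_s (u (cons_cV (s, y)))%:E)%E = (inner y)%:E.
Proof.
rewrite /inner /Rintegral fineK//; apply: integrable_fin_num => //.
exact: (tame_integrable (torus_tame_slice1 y tu)).
Qed.

Lemma torus_tame_inner : torus_tame inner.
Proof.
split.
- apply/measurable_EFinP.
  rewrite (_ : _ \o _ = fubini_G mu (EFin \o u \o (@cons_cV R d))).
    exact: measurable_fubini_G icons.
  by apply/funext => y; rewrite /= -inner_fin.
- case: tu => m [C uC] u0; exists C => y.
  have C0 : 0 <= C by apply: le_trans (uC 0).
  have tI : tame mu (\1_`[- 2^-1, 2^-1] : R -> R) by apply: tame_itv; lra.
  have -> : C = \int[mu]_s (C * \1_`[- 2^-1, 2^-1] s).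
    rewrite RintegralZl//; last exact: tame_integrable.
    by rewrite Rintegral_itv; lra.
  apply: normr_Rintegral_le; [exact: torus_tame_slice1|exact: tameZ|move=> s].
  rewrite indicE; case: (boolP (s \in _)) => [_|]; first by rewrite mulr1.
  rewrite notin_setE/= in_itv/= -ler_norml => s2.
  by rewrite mulr0 u0 ?normr0// => /torus_cons[].
- move=> y yT; transitivity (\int[mu]_(s in setT) (0 : R)).
    by apply: eq_Rintegral => s _; case: tu => _ _ -> // /torus_cons[].
  by rewrite Rintegral_cst// mul0r.
Qed.

(** Fubini, the measure in dimension d + 1 being the image of a product measure. *)
Lemma Rintegral_cV_succ : \int[lam d.+1]_z u z = \int[lam d]_y inner y.
Proof.
rewrite /Rintegral; congr fine.
under [RHS]eq_integral do rewrite -inner_fin.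
rewrite [RHS](integral21_prod_meas1 icons).
rewrite -(@integral_pushforward _ _ _ _ _ _ (@measurable_cons_cV R d)
  (mu \x lam d)%E setT (EFin \o u))//.
- by apply/measurable_EFinP; case: tu.
Qed.

End iterate.
End cube.

(** * Cubic partial sums of Fourier series *)

Section cube_sums.
Context {R : realType}.
Notation mu := (@lebesgue_measure R).
Notation lam d := (@lebesgue_cV R d).
Implicit Types (K : R) (n d : nat).

Definition dirichlet_cV n d (z : 'cV[R]_d) : R :=
  \prod_(i < d) dirichlet n (z i ord0).

Lemma dirichlet_cV_bounded n d : exists C, forall z : 'cV[R]_d, `|dirichlet_cV n z| <= C.
Proof.
exists (\prod_(i < d) n.*2.+1%:R) => z; rewrite normr_prod.
by apply: ler_prod => i _; rewrite normr_ge0 dirichlet_le.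
Qed.

Let sub_cVE d (z e : 'cV[R]_d) i : (z - e) i ord0 = z i ord0 - e i ord0.
Proof. by rewrite !mxE. Qed.

Lemma measurable_dirichlet_cV n d (eta : 'cV[R]_d) :
  measurable_fun setT (fun z : 'cV[R]_d => dirichlet_cV n (z - eta)).
Proof.
apply: measurable_prod => i _; apply: (measurableT_comp (measurable_dirichlet n)).
under eq_fun do rewrite sub_cVE.
apply: measurable_funB => //; exact: measurable_coord.
Qed.

(** For u supported on the torus, this is the value at eta of the cubic partial sum
of the Fourier series of the periodization of u. *)
Definition cube_sum n d (u : 'cV[R]_d -> R) (eta : 'cV[R]_d) : R :=
  \int[lam d]_z (u z * dirichlet_cV n (z - eta)).

Lemma torus_tame_kernel n d (u : 'cV[R]_d -> R) (eta : 'cV[R]_d) :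
  torus_tame u -> torus_tame (fun z => u z * dirichlet_cV n (z - eta)).
Proof.
move=> tu; apply: torus_tameM => //; first exact: measurable_dirichlet_cV.
by have [C HC] := dirichlet_cV_bounded n d; exists C.
Qed.

Lemma torus_tame_kernel1 n d (u : 'cV[R]_d.+1 -> R) (a : R) :
  torus_tame u -> torus_tame (fun z => u z * dirichlet n (z ord0 ord0 - a)).
Proof.
move=> tu; apply: torus_tameM => //.
  apply: (measurableT_comp (measurable_dirichlet n)).
  by apply: measurable_funB => //; exact: measurable_coord.
by have [C HC] := @bounded_dirichlet R n; exists C.
Qed.

(** The partial sum in the first coordinate is taken first, and yields a function
of the other coordinates. *)
Lemma cube_sum_succ n d (u : 'cV[R]_d.+1 -> R) (a : R) (eta : 'cV[R]_d) :
  torus_tame u -> cube_sum n u (cons_cV (a, eta)) =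
  cube_sum n (fun y => \int[mu]_s (u (cons_cV (s, y)) * dirichlet n (s - a))) eta.
Proof.
move=> tu; rewrite /cube_sum Rintegral_cV_succ; last exact: torus_tame_kernel.
apply: eq_Rintegral => y _.
rewrite -RintegralZr//; last first.
  have := tame_integrable (torus_tame_slice1 y (torus_tame_kernel1 n a tu)).
  by under [fun x => _]eq_fun do rewrite cons_cV0.
apply: eq_Rintegral => s _; rewrite -mulrA; congr (_ * _).
rewrite /dirichlet_cV big_ord_recl sub_cVE !cons_cV0; congr (_ * _).
by apply: eq_bigr => i _; rewrite !sub_cVE !cons_cVS.
Qed.

Lemma torus_tame_conv n d (u : 'cV[R]_d.+1 -> R) (a : R) : torus_tame u ->
  torus_tame (fun y => \int[mu]_s (u (cons_cV (s, y)) * dirichlet n (s - a))).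
Proof.
move=> tu; have := torus_tame_inner (torus_tame_kernel1 n a tu).
congr torus_tame; apply/funext => y; apply: eq_Rintegral => s _.
by rewrite cons_cV0.
Qed.

(** A bound for the norm on bounded functions of the one-dimensional partial
sums. *)
Definition lebesgue_bound n : R := 12 * harmonic_sum n.*2.+1.

Lemma lebesgue_bound_ge1 n : 1 <= lebesgue_bound n.
Proof.
rewrite /lebesgue_bound /harmonic_sum big_ord_recl invr1.
have : 0 <= \sum_(i < n.*2) (lift ord0 i).+1%:R^-1 :> R.
  by apply: sumr_ge0 => i _; rewrite invr_ge0.
lra.
Qed.

Lemma conv_dirichlet_le n d (u : 'cV[R]_d.+1 -> R) (a A : R) (y : 'cV[R]_d) :
  torus_tame u -> (forall z, `|u z| <= A) -> `|a| <= 2^-1 ->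
  `|\int[mu]_s (u (cons_cV (s, y)) * dirichlet n (s - a))| <= A * lebesgue_bound n.
Proof.
move=> tu uA a2; have A0 : 0 <= A by apply: le_trans (uA 0).
have tD : tame mu (fun s => \1_`[- 2^-1, 2^-1] s * `|dirichlet n (s - a)|).
  apply: tameM; first by apply: tame_itv; lra.
    apply: measurableT_comp => //; apply: (measurableT_comp (measurable_dirichlet n)).
    exact: measurable_funB.
  by have [B HB] := @bounded_dirichlet R n; exists B => s; rewrite normr_id.
apply: (@le_trans _ _ (\int[mu]_s (A * (\1_`[- 2^-1, 2^-1] s * `|dirichlet n (s - a)|)))).
  apply: normr_Rintegral_le; last 1 first.
  - move=> s; rewrite normrM mulrA; apply: ler_wpM2r => //.
    rewrite indicE; case: (boolP (s \in _)) => [_|]; first by rewrite mulr1.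
    rewrite notin_setE/= in_itv/= -ler_norml => s2; case: tu => _ _ u0.
    by rewrite mulr0 u0 ?normr0// => /torus_cons[].
  - have := torus_tame_slice1 y (torus_tame_kernel1 n a tu).
    by under [fun x => _]eq_fun do rewrite cons_cV0.
  - exact: tameZ.
rewrite RintegralZl//; last exact: tame_integrable.
by rewrite ler_wpM2l//; exact: Rintegral_normr_dirichlet.
Qed.

Lemma cube_sum_le n d (u : 'cV[R]_d -> R) A eta :
  torus_tame u -> (forall z, `|u z| <= A) -> torus eta ->
  `|cube_sum n u eta| <= A * lebesgue_bound n ^+ d.
Proof.
elim: d u A eta => [|d IH] u A eta tu uA etaT.
  rewrite expr0 mulr1 /cube_sum /= /dirichlet_cV.
  under eq_Rintegral do rewrite big_ord0 mulr1.
  rewrite /Rintegral integral_dirac//; last by apply/measurable_EFinP; case: tu.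
  by rewrite diracT mul1e /=.
rewrite -(uncons_cVK eta) in etaT *.
move: (uncons_cV eta) etaT => [a eta'] /torus_cons[a2 etaT].
rewrite cube_sum_succ// exprS mulrA; apply: IH => //.
  exact: torus_tame_conv.
by move=> y; exact: conv_dirichlet_le.
Qed.

(** Stated for two points rather than for a point and an increment, so that the
first coordinate can be frozen without computing with vectors. *)
Definition coord_lipschitz d K (u : 'cV[R]_d -> R) := forall (l : 'I_d) (z z' : 'cV[R]_d),
  (forall i, i != l -> z i ord0 = z' i ord0) ->
  `|u z - u z'| <= K * `|z l ord0 - z' l ord0|.

(** Induction on d.  With a the first coordinate of eta, v the partial sum in that
coordinate and w the section of u at a, the error is the (d - 1)-dimensional
partial sum of v - w, where v - w is small by [dirichlet_approx] and is multiplied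
by at most [lebesgue_bound] for each remaining coordinate, plus the error for w,
which is the induction hypothesis. *)
Lemma cube_sum_approx n d (u : 'cV[R]_d -> R) K eta : 0 <= K ->
  torus_tame u -> coord_lipschitz K u -> torus eta ->
  `|cube_sum n u eta - u eta| <=
    18 * K * (Num.sqrt n.*2.+1%:R)^-1 * (d%:R * lebesgue_bound n ^+ d).
Proof.
move=> K0; set e := _ / _.
have e0 : 0 <= e by rewrite mulr_ge0 ?invr_ge0 ?sqrtr_ge0 ?mulr_ge0.
elim: d u eta => [|d IH] u eta tu uK etaT.
  rewrite mul0r mulr0 /cube_sum /= /dirichlet_cV.
  under eq_Rintegral do rewrite big_ord0 mulr1.
  rewrite /Rintegral integral_dirac//; last by apply/measurable_EFinP; case: tu.
  by rewrite diracT mul1e /= (_ : eta = 0) ?subrr ?normr0//; apply/colP => -[].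
rewrite -(uncons_cVK eta) in etaT *.
move: (uncons_cV eta) etaT => [a eta'] /torus_cons[a2 etaT].
rewrite cube_sum_succ//.
set v := fun y => _; pose w y := u (cons_cV (a, y)).
have tw : torus_tame w := torus_tame_slice2 a tu.
have tv : torus_tame v := torus_tame_conv n a tu.
have vw y : `|v y - w y| <= e.
  apply: (dirichlet_approx (v := fun s => u (cons_cV (s, y)))) => //.
  - by case: (torus_tame_slice1 y tu).
  - move=> s t; have := uK ord0 (cons_cV (s, y)) (cons_cV (t, y)).
    rewrite !cons_cV0; apply => i; case: (unliftP ord0 i) => [k ->|->].
      by rewrite !cons_cVS.
    by rewrite eqxx.
  - move=> s s2; case: tu => _ _; apply => /torus_cons[].
    by rewrite leNgt s2.
have -> : cube_sum n v eta' - u (cons_cV (a, eta')) =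
   cube_sum n (fun y => v y - w y) eta' + (cube_sum n w eta' - w eta').
  rewrite /cube_sum.
  under [X in _ = X + _]eq_Rintegral do rewrite mulrBl.
  rewrite RintegralB//; [|exact/tame_integrable/torus_tameP/torus_tame_kernel..].
  by rewrite addrA subrK.
have L1 := lebesgue_bound_ge1 n; have L0 := le_trans ler01 L1.
have wK : coord_lipschitz K w.
  move=> l y y' yy'; have := uK (lift ord0 l) (cons_cV (a, y)) (cons_cV (a, y')).
  rewrite !cons_cVS; apply => i; case: (unliftP ord0 i) => [k ->|-> _].
    by rewrite !cons_cVS (inj_eq lift_inj); exact: yy'.
  by rewrite !cons_cV0.
have h1 := cube_sum_le n (torus_tameB tv tw) vw etaT.
have h2 := IH w eta' tw wK etaT.
apply: (le_trans (ler_normD _ _)); apply: (le_trans (lerD h1 h2)).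
rewrite -mulrDr ler_wpM2l// exprS -natr1.
have Ld : 0 <= lebesgue_bound n ^+ d by rewrite exprn_ge0.
have d0 : 0 <= d%:R :> R by [].
rewrite -[X in X + _ <= _]mul1r -mulrDl (addrC 1); apply: ler_wpM2l.
  by rewrite addr_ge0.
by rewrite ler_peMl.
Qed.

End cube_sums.

(** * The rate of convergence *)

Section rate.
Context {R : realType}.
Implicit Types (n m d : nat).

Lemma harmonic_sum_le_ln m : harmonic_sum m.+1 <= 1 + ln m.+1%:R :> R.
Proof.
elim: m => [|m IH].
  by rewrite /harmonic_sum big_ord1 invr1 ln1 addr0.
have -> : harmonic_sum m.+2 = harmonic_sum m.+1 + m.+2%:R^-1 :> R.
  by rewrite /harmonic_sum big_ord_recr.
suff : m.+2%:R^-1 <= ln m.+2%:R - ln m.+1%:R :> R.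
  move: IH; move: (ln _) (ln _) (_^-1) => a b c; lra.
have h := @le_ln1Dx R (- m.+2%:R^-1).
have m2 : m.+2%:R != 0 :> R by [].
have E : 1 + - m.+2%:R^-1 = m.+1%:R / m.+2%:R :> R.
  by rewrite -[m.+1%:R](addrK 1) natr1 mulrBl mulfV// mul1r.
rewrite E in h; rewrite -lerN2 opprB -ln_div ?posrE//.
by apply: h; rewrite ltrN2 invf_lt1// ltr1n.
Qed.

(** In terms of y = ln (2n+1), the first factor is exp (- y / 2), the second is at
most (24 y) ^ d once y >= 1, and the exponential series gives
exp (y / 2) >= c y ^ (d + 1). *)
Lemma dirichlet_rate d (eps : R) : 0 < eps ->
  \forall n \near \oo,
    (Num.sqrt n.*2.+1%:R)^-1 * lebesgue_bound n ^+ d <= eps.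
Proof.
move=> e0; pose C : R := 24 ^+ d * (2 ^+ d.+1 * d.+1`!%:R).
have C0 : 0 < C by rewrite !mulr_gt0 ?exprn_gt0// ltr0n fact_gt0.
near=> n.
pose y : R := ln n.*2.+1%:R.
have NE : n.*2.+1%:R = expR y by rewrite lnK// posrE.
have y1 : 1 <= y /\ C / eps <= y.
  have n2 : n%:R <= expR y by rewrite -NE ler_nat leqW// -addnn leq_addr.
  rewrite -(ler_expR 1) -(ler_expR (C / eps)); split; apply: le_trans n2.
    by near: n; exact: nbhs_infty_ger.
  by near: n; exact: nbhs_infty_ger.
move: y1 => [y1 yC]; have y0 : 0 < y by lra.
have -> : Num.sqrt n.*2.+1%:R = expR (y / 2).
  rewrite NE (_ : y = y / 2 + y / 2); last by field.
  by rewrite expRD -expr2 sqrtr_sqr ger0_norm ?expR_ge0// -splitr.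
have Lb : lebesgue_bound n <= 24 * y.
  have := harmonic_sum_le_ln n.*2; rewrite /lebesgue_bound -/y; lra.
have L0 : 0 <= lebesgue_bound n :> R by exact: le_trans ler01 (lebesgue_bound_ge1 n).
have Ld : lebesgue_bound n ^+ d <= 24 ^+ d * y ^+ d.
  by rewrite -exprMn lerXn2r// nnegrE (le_trans L0).
have Ey : y ^+ d.+1 / (2 ^+ d.+1 * d.+1`!%:R) <= expR (y / 2).
  have := @expR_ge1Dxn R (y / 2) d; rewrite expr_div_n -mulrA -invfM => h.
  by have := h ltac:(lra); lra.
rewrite mulrC ler_pdivrMr ?expR_gt0//; apply: (le_trans Ld).
apply: (@le_trans _ _ (eps * (y ^+ d.+1 / (2 ^+ d.+1 * d.+1`!%:R)))); last first.
  by rewrite ler_pM2l.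
rewrite mulrA ler_pdivlMr ?mulr_gt0 ?exprn_gt0 ?ltr0n ?fact_gt0//.
rewrite mulrAC -/C [y ^+ d.+1]exprS [eps * _]mulrA.
apply: ler_wpM2r; first by rewrite exprn_ge0// ltW.
by rewrite [eps * _]mulrC -ler_pdivrMr.
Unshelve. all: by end_near. Qed.

End rate.

(** * Translations and linear maps *)

Section lebesgue_cV_theory.
Context {R : realType}.
Notation mu := (@lebesgue_measure R).
Notation lam d := (@lebesgue_cV R d).

Lemma measurable_addr_cV d (a : 'cV[R]_d) : measurable_fun setT (fun x : 'cV[R]_d => x + a).
Proof.
apply: measurable_cV => i; under eq_fun do rewrite mxE.
apply: measurable_funD => //; exact: measurable_coord.
Qed.

Lemma measurable_mulmx_cV d (P : 'M[R]_d) :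
  measurable_fun setT (fun x : 'cV[R]_d => P *m x).
Proof.
apply: measurable_cV => i; under eq_fun do rewrite mxE.
apply: measurable_sum => j; apply: measurable_funM => //.
exact: measurable_coord.
Qed.

Lemma lebesgue_cV_succE d (A : set 'cV[R]_d.+1) :
  (lam d.+1 A = \int[mu]_s lam d [set y | A (cons_cV (s, y))])%E.
Proof.
rewrite /= /lebesgue_step /pushforward /product_measure1.
apply: eq_integral => s _ /=; congr (lam d _).
by apply/seteqP; split => y; rewrite /xsection /= inE.
Qed.

Lemma lebesgue_cV_shift d (a : 'cV[R]_d) (A : set 'cV[R]_d) : measurable A ->
  lam d [set x | A (x + a)] = lam d A.
Proof.
elim: d a A => [|d IH] a A mA.
  by congr (lam 0%N _); apply/seteqP; split => x /=;
    rewrite (_ : x + a = x)//; apply/colP => -[].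
have mcons s : measurable [set y | A (cons_cV (s, y))].
  by rewrite -[X in measurable X]setTI; exact: measurable_slice2.
pose phi (s : R) := lam d [set y | A (cons_cV (s, y))].
have mphi : measurable_fun setT phi.
  have mA' : measurable (@cons_cV R d @^-1` A).
    by rewrite -[X in measurable X]setTI; exact: measurable_cons_cV.
  have := measurable_fun_xsection (lam d) mA'.
  congr measurable_fun; apply/funext => s; congr (lam d _).
  by apply/seteqP; split => y; rewrite /xsection /= inE.
rewrite !lebesgue_cV_succE -(uncons_cVK a); case: (uncons_cV a) => [b c].
transitivity (\int[mu]_s phi ((s + b)%R))%E.
  apply: eq_integral => s _; rewrite /phi -[RHS](IH c)//; congr (lam d _).
  suff E y : cons_cV (s, y) + cons_cV (b, c) = cons_cV (s + b, y + c).
    by apply/seteqP; split => y /=; rewrite E.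
  apply/colP => i; case: (unliftP ord0 i) => [k ->|->].
    by rewrite [LHS]mxE !cons_cVS [RHS]mxE.
  by rewrite [LHS]mxE !cons_cV0.
rewrite -(@ge0_integral_pushforward _ _ _ _ _ _ (measurable_shift b) mu setT phi)//.
have ms := @measurable_shift R b.
apply: eq_measure_integral => B mB _; exact: (lebesgue_measure_shift b mB).
Qed.

Lemma lebesgue_cV_setT_gt0 d : (0 < lam d setT)%E.
Proof.
apply: (@lt_le_trans _ _ (lam d torus)).
  rewrite torus_box (@lebesgue_cV_box R d (fun=> `[- 2^-1, 2^-1]%classic)); last first.
    by move=> i; exact: measurable_itv.
  rewrite big1 ?lte01// => i _; rewrite [LHS]lebesgue_measure_bounded_itv; last by lra.
  by congr EFin; lra.
by apply: le_measure; rewrite ?inE//; exact: measurable_torus.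
Qed.

(** For a null set N, integrate the indicator of P x + y in N over all x and y.
Integrating in y first gives 0, as the translates of N are null.  Integrating in x
first gives, for every y, the measure of a translate of the preimage of N under P,
hence that measure times the measure of the whole space, which is positive.  So
the preimage is null, without any formula for the image of the measure. *)
Lemma negligible_preimage_mulmx d (P : 'M[R]_d) (A : set 'cV[R]_d) :
  P \in unitmx -> (lam d).-negligible A ->
  (lam d).-negligible [set x | A (P *m x)].
Proof.
move=> uP [N [mN N0 AN]].
exists [set x | N (P *m x)]; split; last by move=> x /= /AN.
  by rewrite -[X in measurable X]setTI; exact: measurable_mulmx_cV.
pose D : set ('cV[R]_d * 'cV[R]_d) := [set p | N (P *m p.1 + p.2)].
have mD : measurable D.
  rewrite -[X in measurable X]setTI.
  apply: (_ : measurable_fun setT (fun p : 'cV[R]_d * 'cV[R]_d => P *m p.1 + p.2)) => //.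
  apply: measurable_cV => i; under eq_fun do rewrite mxE.
  apply: measurable_funD.
    apply: (measurableT_comp (f := fun x : 'cV[R]_d => (P *m x) i ord0)) => //.
    apply: (measurableT_comp (measurable_coord i)); exact: measurable_mulmx_cV.
  apply: (measurableT_comp (f := fun x : 'cV[R]_d => x i ord0)) => //.
  exact: measurable_coord.
have mf : measurable_fun setT (EFin \o (\1_D : _ -> R)).
  by apply/measurable_EFinP; exact: measurable_indic.
have f0 p : (0 <= (EFin \o (\1_D : _ -> R)) p)%E by rewrite /= lee_fin.
have := @fubini_tonelli _ _ _ _ _ (lam d) (lam d) _ mf f0.
have mshift (B : set 'cV[R]_d) a : measurable B -> measurable [set y | B (y + a)].
  by move=> mB; rewrite -[X in measurable X]setTI; exact: measurable_addr_cV.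
have indicf (B : set 'cV[R]_d) (f : 'cV[R]_d -> R) : measurable B ->
    (forall y, f y = \1_B y) -> (\int[lam d]_y (f y)%:E = lam d B)%E.
  move=> mB fB; under eq_integral do rewrite fB.
  by rewrite integral_indic// setIT.
rewrite [LHS](_ : _ = 0%E); last first.
  apply: integral0_eq => x _; rewrite /fubini_F /=.
  rewrite (indicf [set y | N (y + P *m x)]) ?lebesgue_cV_shift//.
    exact: mshift.
  by move=> y; rewrite !indicE; congr (nat_of_bool _)%:R;
    apply/idP/idP; rewrite !inE /D/= addrC.
rewrite [RHS](_ : _ = \int[lam d]_y lam d [set x | N (P *m x)])%E; last first.
  apply: eq_integral => y _; rewrite /fubini_G /=.
  have mPN : measurable [set x | N (P *m x)].
    by rewrite -[X in measurable X]setTI; exact: measurable_mulmx_cV.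
  rewrite -(lebesgue_cV_shift (invmx P *m y) mPN).
  apply: indicf; first exact: mshift.
  by move=> x; rewrite !indicE; congr (nat_of_bool _)%:R;
    apply/idP/idP; rewrite !inE /D/= mulmxDr mulKVmx.
rewrite integral_cst// => /esym/eqP; rewrite mule_eq0.
by rewrite [X in _ || X]gt_eqF ?orbF ?lebesgue_cV_setT_gt0// => /eqP.
Qed.

End lebesgue_cV_theory.

(** * Supports *)

Section supports.
Context {R : realType} {d : nat}.
Notation mu := (@lebesgue_measure R).
Notation lam := (@lebesgue_cV R d).

Lemma open_cV_box (U : set 'cV[R]_d) (x : 'cV[R]_d) : open U -> U x ->
  exists2 e : R, 0 < e & forall y : 'cV[R]_d,
    (forall i, `|x i ord0 - y i ord0| < e) -> U y.
Proof.
move=> oU Ux; have : nbhs x U by exact: open_nbhs_nbhs.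
move=> /nbhs_ballP[e /= e0 eU]; exists e => // y xy; apply: eU.
by split => // i j; rewrite (ord1 j); exact: xy.
Qed.

(** The union of all open sets on which u vanishes almost everywhere is covered by
the countably many cubes with rational centre and radius 1 / (n + 1) that have the
same property. *)
Lemma ae_zero_off_supp (u : 'cV[R]_d -> R[i]) :
  {ae lam, forall x, ~ supp u x -> u x = 0}.
Proof.
pose box (p : 'cV[rat]_d * nat) : set 'cV[R]_d :=
  [set x | forall i, `|ratr (p.1 i ord0) - x i ord0| < p.2.+1%:R^-1].
pose F (k : nat) : set 'cV[R]_d :=
  if (unpickle k : option ('cV[rat]_d * nat)) is Some p then
    if pselect {ae lam, forall x, box p x -> u x = 0} then
      [set x | box p x /\ u x <> 0] else set0
  else set0.
have nF k : lam.-negligible (F k).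
  rewrite /F; case: (unpickle k) => [p|]; last exact: negligible_set0.
  case: pselect => h; last exact: negligible_set0.
  by apply: negligibleS h => x /= [px ux] /(_ px).
apply: negligibleS (negligible_bigcup nF) => x /= /not_implyP[xs ux].
move: xs; rewrite /supp /= => /contrapT[U /= [oU Uu] Ux].
have [e e0 eU] := open_cV_box oU Ux.
have [n en] : exists n : nat, n.+1%:R^-1 < e / 2.
  have := near_infty_natSinv_lt (PosNum (divr_gt0 e0 (ltr0n R 2))).
  by move=> [n _ H]; exists n; apply: H => /=.
have rat_near i : exists q : rat, `|ratr q - x i ord0| < n.+1%:R^-1.
  have n0 : 0 < n.+1%:R^-1 :> R by [].
  have xx : x i ord0 - n.+1%:R^-1 < x i ord0 + n.+1%:R^-1.
    by rewrite ltrD2l gtrN.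
  have [q] := rat_in_itvoo xx.
  rewrite in_itv/= => /andP[q1 q2]; exists q; rewrite ltr_norml.
  by rewrite ltrBlDl q2 andbT ltrBrDr addrC.
have [q qx] := choice rat_near.
pose p : 'cV[rat]_d * nat := (\col_i q i, n).
exists (pickle p) => //; rewrite /F pickleK.
have px : box p x by move=> i /=; rewrite mxE.
case: pselect => // -[]; apply: filterS Uu => y Uy py; apply: Uy; apply: eU => i.
have := px i; have := py i; rewrite /= mxE => h1 h2.
rewrite -(subrK (ratr (q i)) (x i ord0)) -addrA.
apply: (le_lt_trans (ler_normD _ _)); rewrite distrC.
by move: (ltrD h1 h2); move: en; move: (_^-1) => w; lra.
Qed.

(** The coordinates of x are replaced by those of y one at a time. *)
Lemma coord_lipschitz_sum K (u : 'cV[R]_d -> R) : coord_lipschitz K u ->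
  forall x y, `|u x - u y| <= K * \sum_i `|x i ord0 - y i ord0|.
Proof.
move=> uK x y.
pose h (m : nat) : 'cV[R]_d := \col_i (if (i < m)%N then y i ord0 else x i ord0).
suff H m : (m <= d)%N ->
    `|u x - u (h m)| <= K * \sum_(i < d | (i < m)%N) `|x i ord0 - y i ord0|.
  have := H d (leqnn d); rewrite (_ : h d = y).
    by rewrite (eq_bigl xpredT)// => i; rewrite ltn_ord.
  by apply/colP => i; rewrite mxE ltn_ord.
elim: m => [|m IH] md.
  rewrite (_ : h 0%N = x) ?subrr ?normr0 ?big_pred0 ?mulr0//.
  by apply/colP => i; rewrite mxE.
rewrite (bigD1 (Ordinal md))//=.
have -> : u x - u (h m.+1) = (u (h m) - u (h m.+1)) + (u x - u (h m)) by ring.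
rewrite mulrDr; apply: (le_trans (ler_normD _ _)); apply: lerD.
  have := uK (Ordinal md) (h m) (h m.+1); rewrite !mxE/= ltnn ltnSn; apply.
  move=> i im; rewrite !mxE ltnS (leq_eqVlt i).
  suff /negbTE -> : (i : nat) != m by [].
  by apply: contraNneq im => E; apply/eqP/val_inj.
apply: le_trans (IH (ltnW md)) _; rewrite le_eqVlt; apply/orP; left; apply/eqP.
congr (_ * _); apply: eq_bigl => i; rewrite ltnS [in RHS]leq_eqVlt -val_eqE/=.
by case: ltngtP.
Qed.

(** If u did not vanish at x, it would not vanish on a small cube around x, which
has positive measure. *)
Lemma coord_lipschitz_ae_zero K (u : 'cV[R]_d -> R) (U : set 'cV[R]_d) x :
  coord_lipschitz K u -> open U -> {ae lam, forall y, U y -> u y = 0} -> U x ->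
  u x = 0.
Proof.
move=> uK oU uU Ux; apply/eqP/negPn/negP => ux.
have [e e0 eU] := open_cV_box oU Ux.
(* small enough for the cube of radius r around x to lie in U, and for u to move
by at most half of |u x| on it *)
pose r := Num.min (e / 2) (`|u x| / 2 / (`|K| + 1) / d.+1%:R).
have K1 : 0 < `|K| + 1 by rewrite ltr_wpDl.
have r0 : 0 < r by rewrite lt_min !divr_gt0 ?normr_gt0.
pose Q := [set y : 'cV[R]_d | forall i, `[x i ord0 - r, x i ord0 + r]%classic (y i ord0)].
have Qpos : (0 < lam Q)%E.
  rewrite (@lebesgue_cV_box R d (fun i => `[x i ord0 - r, x i ord0 + r]%classic)).
    rewrite (eq_bigr (fun=> (r + r)%:E)) ?prodEFin ?lte_fin ?prodr_gt0// => [i _|i _].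
      by rewrite addr_gt0.
    by rewrite [LHS]lebesgue_measure_bounded_itv; [congr EFin; ring|lra].
  by move=> i; exact: measurable_itv.
have mQ : measurable Q.
  apply: (@measurable_box R d (fun i => `[x i ord0 - r, x i ord0 + r]%classic)) => i.
  exact: measurable_itv.
have nQ : lam.-negligible Q.
  apply: negligibleS uU => y Qy /=.
  have yr i : `|x i ord0 - y i ord0| <= r.
    by have := Qy i; rewrite /= in_itv/= ler_norml; lra.
  have Uy : U y.
    apply: eU => i; apply: (le_lt_trans (yr i)).
    rewrite (@le_lt_trans _ _ (e / 2)) ?ge_min ?lexx//; lra.
  move=> /(_ Uy) uy.
  have := coord_lipschitz_sum uK x y; rewrite uy subr0.
  have S0 : 0 <= \sum_i `|x i ord0 - y i ord0| by exact: sumr_ge0.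
  have Sr : \sum_i `|x i ord0 - y i ord0| <= d.+1%:R * r.
    apply: (@le_trans _ _ (\sum_(i < d) r)); first exact: ler_sum.
    rewrite sumr_const card_ord -[r *+ d]mulr_natl ler_wpM2r ?ler_nat//; exact: ltW.
  have KS : K * \sum_i `|x i ord0 - y i ord0| <= (`|K| + 1) * (d.+1%:R * r).
    apply: (@le_trans _ _ ((`|K| + 1) * \sum_i `|x i ord0 - y i ord0|)).
      by apply: ler_wpM2r => //; rewrite (le_trans (ler_norm K))// lerDl.
    by rewrite ler_wpM2l// ltW.
  have rE : (`|K| + 1) * (d.+1%:R * r) <= `|u x| / 2.
    rewrite mulrA mulrC -ler_pdivlMr ?mulr_gt0// invfM mulrA.
    by rewrite /r ge_min lexx orbT.
  move=> /le_trans /(_ KS) /le_trans /(_ rE).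
  have : 0 < `|u x| by rewrite normr_gt0.
  lra.
by move: Qpos; rewrite ((negligibleP _ mQ).1 nQ) ltxx.
Qed.

End supports.

(** * Exponential sums over cubes of the lattice *)

Section complex_facts.
Context {R : realType}.
Implicit Types (z w : R[i]) (s t : R).

Lemma complexReM z w :
  complex.Re (z * w) = complex.Re z * complex.Re w - complex.Im z * complex.Im w.
Proof. by case: z w => a b [c e]. Qed.

Lemma complexImM z w :
  complex.Im (z * w) = complex.Re z * complex.Im w + complex.Im z * complex.Re w.
Proof. by case: z w => a b [c e]; rewrite /= addrC. Qed.

Lemma complexReD z w : complex.Re (z + w) = complex.Re z + complex.Re w.
Proof. by case: z w => a b [c e]. Qed.

Lemma complexImD z w : complex.Im (z + w) = complex.Im z + complex.Im w.
Proof. by case: z w => a b [c e]. Qed.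

Lemma complexReJ z : complex.Re z^* = complex.Re z.
Proof. by case: z. Qed.

Lemma complexImJ z : complex.Im z^* = - complex.Im z.
Proof. by case: z. Qed.

Lemma normc_conj z : normc z^* = normc z.
Proof. by case: z => a b /=; rewrite sqrrN. Qed.

Lemma complexRe_sum (I : Type) (r : seq I) (F : I -> R[i]) :
  complex.Re (\sum_(i <- r) F i) = \sum_(i <- r) complex.Re (F i).
Proof. by elim: r => [|i r IH]; rewrite ?big_nil// !big_cons complexReD IH. Qed.

Lemma complexIm_sum (I : Type) (r : seq I) (F : I -> R[i]) :
  complex.Im (\sum_(i <- r) F i) = \sum_(i <- r) complex.Im (F i).
Proof. by elim: r => [|i r IH]; rewrite ?big_nil// !big_cons complexImD IH. Qed.

Lemma normr_Re_le z : `|complex.Re z| <= normc z.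
Proof.
case: z => a b; rewrite /normc -sqrtr_sqr; apply: ler_wsqrtr.
by rewrite lerDl sqr_ge0.
Qed.

Lemma normr_Im_le z : `|complex.Im z| <= normc z.
Proof.
case: z => a b; rewrite /normc -sqrtr_sqr; apply: ler_wsqrtr.
by rewrite lerDr sqr_ge0.
Qed.

Lemma normc_le z : normc z <= `|complex.Re z| + `|complex.Im z|.
Proof.
case: z => a b /=; rewrite -[leRHS]ger0_norm ?addr_ge0// -sqrtr_sqr.
apply: ler_wsqrtr; rewrite sqrrD !real_normK ?num_real// -addrA lerD2l lerDr.
by rewrite mulrn_wge0// mulr_ge0.
Qed.

Lemma e2piD s t : e2pi (s + t) = e2pi s * e2pi t.
Proof.
apply/eqP; rewrite eq_complex complexReM complexImM /=.
by rewrite mulrDr cosD sinD addrC eqxx /= addrC eqxx.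
Qed.

Lemma e2pi0 : e2pi 0 = 1 :> R[i].
Proof. by rewrite /e2pi mulr0 cos0 sin0. Qed.

Lemma e2piJ t : (e2pi t)^* = e2pi (- t).
Proof. by apply/eqP; rewrite eq_complex complexReJ complexImJ /= mulrN cosN sinN !eqxx. Qed.

Lemma e2pi_sum (I : Type) (r : seq I) (F : I -> R) :
  e2pi (\sum_(i <- r) F i) = \prod_(i <- r) e2pi (F i).
Proof. by elim: r => [|i r IH]; rewrite ?big_nil ?e2pi0// !big_cons e2piD IH. Qed.

Lemma normr_Re_e2pi t : `|complex.Re (e2pi t)| <= 1.
Proof. exact: cos_max. Qed.

Lemma normr_Im_e2pi t : `|complex.Im (e2pi t)| <= 1.
Proof. exact: sin_max. Qed.

(** The imaginary parts cancel under the reflection of the summation range. *)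
Lemma sum_e2pi n t :
  \sum_(j < n.*2.+1) e2pi ((j%:R - n%:R) * t) = (dirichlet n t)%:C.
Proof.
apply/eqP; rewrite eq_complex complexRe_sum complexIm_sum /=; apply/andP; split.
  by apply/eqP/eq_bigr => j _; rewrite mulrA.
set S := \sum_(_ < _) _.
suff : S = - S by move=> /eqP; rewrite -addr_eq0 -mulr2n mulrn_eq0.
rewrite {1}/S (reindex_inj rev_ord_inj)/= /S -sumrN; apply: eq_bigr => j _.
rewrite -sinN subSS natrB; last by rewrite -ltnS.
by have -> : n.*2%:R = 2 * n%:R :> R; [rewrite -muln2 natrM mulrC|congr sin; ring].
Qed.

End complex_facts.

Section lattice.
Context {R : realType} {d : nat}.

Definition lattice_point (n : nat) (p : {ffun 'I_d -> 'I_n.*2.+1}) : 'cV[int]_d :=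
  \col_i (Posz (p i) - Posz n).

Lemma cube_fsbig (V : zmodType) n (G : 'cV[int]_d -> V) :
  \sum_(k \in [set k : 'cV[int]_d | `|k| <= n%:Z]) G k =
  \sum_p G (@lattice_point n p).
Proof.
have normP (k : 'cV[int]_d) : `|k| <= n%:Z <-> forall i, `|k i ord0| <= n%:Z.
  rewrite /Num.norm/= mx_normrE; split=> [h i|h].
    apply: le_trans h; exact: (le_bigmax_cond _ (fun ij => `|k ij.1 ij.2|) (j := (i, ord0))).
  apply: bigmax_le => // -[i j] _ /=; rewrite (ord1 j); exact: h.
rewrite (@reindex_fsbig _ _ _ _ _ (@lattice_point n) setT); last first.
  split=> [p _ /=|p q _ _ /colP pq|k0 /=]; last move: (k0 : 'cV[int]_d) => {k0} k.
  - apply/normP => i; rewrite mxE ler_norml; case: (p i) => m mn /=; lia.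
  - apply/ffunP => i; apply/val_inj; by have := pq i; rewrite !mxE => /addIr[].
  - move=> /normP kn.
    have h i : (absz (k i ord0 + n%:Z)%R < n.*2.+1)%N.
      by have := kn i; rewrite ler_norml; move: (k i ord0) => z; lia.
    exists [ffun i => Ordinal (h i)] => //; apply/colP => i.
    by rewrite mxE ffunE /=; have := kn i; rewrite ler_norml; move: (k i ord0) => z; lia.
rewrite [RHS]fsbig_seq ?index_enum_uniq//.
rewrite (_ : [set` index_enum {ffun 'I_d -> 'I_n.*2.+1}] = setT)//.
by apply/seteqP; split => p //= _; rewrite mem_index_enum.
Qed.

(** Expanding the product over the coordinates of the one-dimensional sums yields
one term for each choice of an index in every coordinate. *)
Lemma sum_lattice_e2pi n (t : 'cV[R]_d) :
  \sum_p e2pi (inner (map_mx intr (@lattice_point n p)) t) = (dirichlet_cV n t)%:C.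
Proof.
under eq_bigr do rewrite /inner e2pi_sum.
rewrite /dirichlet_cV rmorph_prod/=.
under [RHS]eq_bigr do rewrite -sum_e2pi.
rewrite bigA_distr_bigA; apply: eq_bigr => p _; apply: eq_bigr => i _.
by rewrite !mxE rmorphB.
Qed.

End lattice.

(** * Complex-valued integrals *)

Section complex_integrals.
Context {R : realType} {d : nat}.
Notation lam := (@lebesgue_cV R d).
Implicit Types (D : set 'cV[R]_d) (u v : 'cV[R]_d -> R[i]).

Definition cintegrable D u :=
  lam.-integrable D (fun x => (complex.Re (u x))%:E) /\
  lam.-integrable D (fun x => (complex.Im (u x))%:E).

Definition cbounded D u := exists C : R, forall x, D x -> normc (u x) <= C.

Lemma eq_cintegral D u v : (forall x, D x -> u x = v x) ->
  cintegral D u = cintegral D v.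
Proof.
by move=> uv; congr Complex; apply: eq_Rintegral => x /set_mem/uv ->.
Qed.

Lemma cintegrableD D u v : measurable D -> cintegrable D u -> cintegrable D v ->
  cintegrable D (fun x => u x + v x).
Proof.
move=> mD [ru iu] [rv iv]; split.
  by under eq_fun do rewrite complexReD EFinD; exact: integrableD.
by under eq_fun do rewrite complexImD EFinD; exact: integrableD.
Qed.

Lemma cintegralD D u v : measurable D -> cintegrable D u -> cintegrable D v ->
  cintegral D (fun x => u x + v x) = cintegral D u + cintegral D v.
Proof.
move=> mD [ru iu] [rv iv]; rewrite /cintegral.
under eq_Rintegral do rewrite complexReD.
under [X in Complex _ X]eq_Rintegral do rewrite complexImD.
by rewrite !RintegralD.
Qed.

Lemma cintegrableM D u v : measurable D -> cintegrable D u ->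
  cmeasurable_fun D v -> cbounded D v -> cintegrable D (fun x => u x * v x).
Proof.
move=> mD [ru iu] [mrv miv] [C vC].
have bRe : [bounded complex.Re (v x) | x in D].
  exists C; split; first exact: num_real.
  by move=> y Cy x Dx; exact: le_trans (normr_Re_le _) (le_trans (vC x Dx) (ltW Cy)).
have bIm : [bounded complex.Im (v x) | x in D].
  exists C; split; first exact: num_real.
  by move=> y Cy x Dx; exact: le_trans (normr_Im_le _) (le_trans (vC x Dx) (ltW Cy)).
split.
  under eq_fun do rewrite complexReM EFinB !EFinM.
  by apply: integrableB => //; exact: integrableMl.
under eq_fun do rewrite complexImM EFinD !EFinM.
by apply: integrableD => //; exact: integrableMl.
Qed.

Lemma cintegralZr D u (c : R[i]) : measurable D -> cintegrable D u ->
  cintegral D (fun x => u x * c) = cintegral D u * c.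
Proof.
move=> mD [ru iu]; apply/eqP; rewrite eq_complex complexReM complexImM /cintegral /=.
under eq_Rintegral do rewrite complexReM.
under [X in _ && (X == _)]eq_Rintegral do rewrite complexImM.
have Z (f : 'cV[R]_d -> R) r : lam.-integrable D (EFin \o f) ->
    lam.-integrable D (EFin \o (fun x => f x * r)).
  move=> fi; have := integrableZr mD r fi.
  by congr (_.-integrable _ _); apply/funext => x /=; rewrite EFinM.
rewrite RintegralB ?RintegralD//; try exact: Z.
by rewrite !RintegralZr// !eqxx.
Qed.

Lemma cintegrable_sum D (I : Type) (r : seq I) (F : I -> 'cV[R]_d -> R[i]) :
  measurable D -> (forall i, cintegrable D (F i)) ->
  cintegrable D (fun x => \sum_(i <- r) F i x).
Proof.
move=> mD iF; elim: r => [|i r IH].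
  under eq_fun do rewrite big_nil.
  by split; exact: integrable0.
by under eq_fun do rewrite big_cons; exact: cintegrableD.
Qed.

Lemma cintegral_sum D (I : Type) (r : seq I) (F : I -> 'cV[R]_d -> R[i]) :
  measurable D -> (forall i, cintegrable D (F i)) ->
  cintegral D (fun x => \sum_(i <- r) F i x) = \sum_(i <- r) cintegral D (F i).
Proof.
move=> mD iF; elim: r => [|i r IH].
  rewrite big_nil; under [LHS]eq_cintegral do rewrite big_nil.
  by apply/eqP; rewrite eq_complex /= !Rintegral_cst// !mul0r !eqxx.
rewrite big_cons -IH -cintegralD//; last exact: cintegrable_sum.
by apply: eq_cintegral => x _; rewrite big_cons.
Qed.

Lemma ae_eq_cintegral D u v : measurable D ->
  cmeasurable_fun D u -> cmeasurable_fun D v ->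
  {ae lam, forall x, D x -> u x = v x} -> cintegral D u = cintegral D v.
Proof.
move=> mD [mru miu] [mrv miv] uv; rewrite /cintegral /Rintegral.
congr (fine _ +i* fine _); apply: ae_eq_integral => //; try exact/measurable_EFinP.
  by apply: filterS uv => x /[apply] ->.
by apply: filterS uv => x /[apply] ->.
Qed.

Lemma cintegral_restrict D u : measurable D -> cmeasurable_fun setT u ->
  {ae lam, forall x, ~ D x -> u x = 0} -> cintegral setT u = cintegral D u.
Proof.
move=> mD [mr mi] u0; rewrite /cintegral.
rewrite [X in _ = X +i* _]Rintegral_mkcond [X in _ = _ +i* X]Rintegral_mkcond.
have mp (f : 'cV[R]_d -> R) : measurable_fun setT f -> measurable_fun setT (f \_ D).
  move=> mf; apply/measurable_restrict => //; rewrite setTI.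
  exact: measurable_funS mf.
congr (fine _ +i* fine _); apply: ae_eq_integral => //;
  try (apply/measurable_EFinP => //; exact: mp).
  apply: filterS u0 => x ux _ /=; rewrite patchE.
  by case: ifPn => // /negP xD; rewrite ux// => Dx; apply: xD; rewrite inE.
apply: filterS u0 => x ux _ /=; rewrite patchE.
by case: ifPn => // /negP xD; rewrite ux// => Dx; apply: xD; rewrite inE.
Qed.

(** Comparable with the L^1 norm of u, and integrable as soon as the two components
are. *)
Definition l1_bound D u : R :=
  \int[lam]_(x in D) (`|complex.Re (u x)| + `|complex.Im (u x)|).

Lemma l1_bound_ge0 D u : 0 <= l1_bound D u.
Proof. by apply: Rintegral_ge0 => x _; rewrite addr_ge0. Qed.

Lemma normc_cintegralM_le D u v (e : R) : measurable D -> cintegrable D u ->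
  cintegrable D (fun x => u x * v x) ->
  (forall x, D x -> `|complex.Re (v x)| <= e /\ `|complex.Im (v x)| <= e) ->
  normc (cintegral D (fun x => u x * v x)) <= l1_bound D u * e *+ 2.
Proof.
move=> mD [ru iu] [ruv iuv] ve.
have il1 : lam.-integrable D
    (EFin \o (fun x => `|complex.Re (u x)| + `|complex.Im (u x)|)).
  have := integrableD mD (integrable_norm ru) (integrable_norm iu).
  by congr (_.-integrable _ _).
have il1e : lam.-integrable D
    (EFin \o (fun x => (`|complex.Re (u x)| + `|complex.Im (u x)|) * e)).
  have := integrableZr mD e il1.
  by congr (_.-integrable _ _); apply/funext => x /=; rewrite -EFinM.
apply: (le_trans (normc_le _)); rewrite mulr2n -[_ * e]RintegralZr//.
apply: lerD => /=.
  apply: (le_trans (le_normr_Rintegral mD ruv)).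
  apply: le_Rintegral => //; first exact: integrable_norm.
  move=> x Dx; have [v1 v2] := ve x Dx; rewrite complexReM mulrDl.
  apply: (le_trans (ler_normB _ _)); rewrite !normrM.
  by apply: lerD; apply: ler_wpM2l.
apply: (le_trans (le_normr_Rintegral mD iuv)).
apply: le_Rintegral => //; first exact: integrable_norm.
move=> x Dx; have [v1 v2] := ve x Dx; rewrite complexImM mulrDl.
apply: (le_trans (ler_normD _ _)); rewrite !normrM.
by apply: lerD; apply: ler_wpM2l.
Qed.

End complex_integrals.

(** * The modulated symbol *)

Section symbol.
Context {R : realType} {d : nat}.
Notation lam := (@lebesgue_cV R d).
Implicit Types (u : 'cV[R]_d -> R) (y eta z : 'cV[R]_d).

(** The mean value theorem along the line through z and z'. *)
Lemma partial_coord_lipschitz u K :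
  (forall x l, derivable u x (basis_vec l)) ->
  (forall x l, `|'D_(basis_vec l) u x| <= K) -> coord_lipschitz K u.
Proof.
move=> du uK l z z'.
wlog zz : z z' / z' l ord0 <= z l ord0.
  move=> H zE; case: (leP (z' l ord0) (z l ord0)) => [|/ltW]; first by move/H; exact.
  by move=> /H; rewrite distrC (distrC (z l ord0)); apply => i il; rewrite zE.
move=> zE; pose v : 'cV[R]_d := basis_vec l; pose t := z l ord0 - z' l ord0.
have zt : z = z' + t *: v.
  apply/colP => i; rewrite !mxE eqxx andbT.
  have [->|il] := eqVneq i l; first by rewrite mulr1 /t addrC subrK.
  by rewrite mulr0 addr0 zE.
pose G s := u (z' + s *: v).
have dG s : is_derive s (1 : R) G ('D_v u (z' + s *: v)).
  have E : (fun h : R => h^-1 *: ((G \o shift s) (h *: (1 : R)) - G s)) =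
      (fun h : R => h^-1 *: ((u \o shift (z' + s *: v)) (h *: v) - u (z' + s *: v))).
    apply/funext => h /=; rewrite (_ : h *: (1 : R) = h); last exact: mulr1.
    by congr (_ *: (u _ - _)); rewrite scalerDl addrCA.
  apply: DeriveDef; first by rewrite /derivable E; exact: du.
  by rewrite /derive E.
have t0 : 0 <= t by rewrite subr_ge0.
have cG : {within `[0, t], continuous G}.
  apply: derivable_within_continuous => s _; apply: ex_derive.
have [c _] := MVT_segment t0 (fun s _ => dG s) cG.
rewrite /G scale0r addr0 -zt subr0 => ->.
by rewrite -/t normrM; apply: ler_wpM2r => //; exact: uK.
Qed.

Lemma coord_lipschitz_bounded u K : coord_lipschitz K u ->
  (forall x, ~ torus x -> u x = 0) -> exists C, forall x, `|u x| <= C.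
Proof.
move=> uK u0; exists (`|u 0| + `|K| * d%:R) => x.
have [xT|xT] := pselect (torus x); last by rewrite u0// normr0 addr_ge0.
have := coord_lipschitz_sum uK x 0.
have S1 : \sum_i `|x i ord0 - (0 : 'cV[R]_d) i ord0| <= d%:R.
  rewrite -[leRHS](_ : \sum_(i < d) 1 = _); last by rewrite sumr_const card_ord.
  apply: ler_sum => i _; rewrite mxE subr0 (le_trans (xT i))//; lra.
have S0 : 0 <= \sum_i `|x i ord0 - (0 : 'cV[R]_d) i ord0| by exact: sumr_ge0.
have S2 : K * \sum_i `|x i ord0 - (0 : 'cV[R]_d) i ord0| <= `|K| * d%:R.
  by apply: le_trans (ler_wpM2r S0 (ler_norm K)) _; exact: ler_wpM2l.
move=> h; rewrite -[u x](subrK (u 0)) addrC (le_trans (ler_normD _ _))// lerD2l.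
exact: le_trans h S2.
Qed.

Lemma coord_lipschitzM u v K L C : coord_lipschitz K u -> coord_lipschitz L v ->
  0 <= L -> (forall x, `|u x| <= C) -> (forall x, `|v x| <= 1) ->
  coord_lipschitz (K + C * L) (fun x => u x * v x).
Proof.
move=> uK vL L0 uC v1 l z z' zz.
have -> : u z * v z - u z' * v z' = (u z - u z') * v z + u z' * (v z - v z') by ring.
apply: (le_trans (ler_normD _ _)); rewrite [leRHS]mulrDl !normrM; apply: lerD.
  by apply: le_trans (uK l z z' zz); apply: ler_piMr.
by rewrite -mulrA; apply: ler_pM => //; exact: vL.
Qed.

Lemma coord_lipschitzD u v K L : coord_lipschitz K u -> coord_lipschitz L v ->
  coord_lipschitz (K + L) (fun x => u x + v x).
Proof.
move=> uK vL l z z' zz.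
have -> : u z + v z - (u z' + v z') = (u z - u z') + (v z - v z') by ring.
apply: (le_trans (ler_normD _ _)); rewrite mulrDl.
by apply: lerD; [exact: uK|exact: vL].
Qed.

Lemma coord_lipschitzN u K : coord_lipschitz K u -> coord_lipschitz K (fun x => - u x).
Proof. by move=> uK l z z' zz; rewrite -opprD normrN; exact: uK. Qed.

Definition wave_lipschitz y : R := 2 * pi * \sum_i `|y i ord0|.

Lemma wave_lipschitz_ge0 y : 0 <= wave_lipschitz y.
Proof. by rewrite mulr_ge0 ?mulr_ge0 ?pi_ge0// sumr_ge0. Qed.

Lemma coord_lipschitz_wave (w : R -> R) y : (forall s t, `|w s - w t| <= `|s - t|) ->
  coord_lipschitz (wave_lipschitz y) (fun z => w (2 * pi * inner y z)).
Proof.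
move=> wl l z z' zz; apply: (le_trans (wl _ _)).
have -> : 2 * pi * inner y z - 2 * pi * inner y z' =
    2 * pi * (y l ord0 * (z l ord0 - z' l ord0)).
  rewrite -mulrBr /inner -sumrB (bigD1 l)//= big1; last first.
    by move=> i il; rewrite zz// subrr.
  by rewrite addr0 -mulrBr.
have p0 : 0 <= 2 * pi :> R by rewrite mulr_ge0 ?pi_ge0.
rewrite normrM (ger0_norm p0) normrM /wave_lipschitz -!mulrA.
rewrite ler_pM2l// ler_pM2l ?pi_gt0//; apply: ler_wpM2r => //.
by rewrite (bigD1 l)//= lerDl sumr_ge0.
Qed.

Lemma measurable_inner y : measurable_fun setT (fun z => inner y z).
Proof.
apply: measurable_sum => i; apply: measurable_funM => //; exact: measurable_coord.
Qed.

Lemma cmeasurable_wave y : cmeasurable_fun setT (fun z => e2pi (inner y z)).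
Proof.
split; [apply: (measurableT_comp measurable_cos)|apply: (measurableT_comp measurable_sin)];
  by apply: measurable_funM => //; exact: measurable_inner.
Qed.

Variables (phihat : 'cV[R]_d -> R[i]) (B : R).
Hypotheses (supp_phihat : supp phihat `<=` torus)
  (mphihat : cmeasurable_fun setT phihat)
  (phihat_partial : forall xi l,
       has_partial l phihat xi /\ normc (partial l phihat xi) <= B).

Let lipRe : coord_lipschitz `|B| (fun z => complex.Re (phihat z)).
Proof.
apply: partial_coord_lipschitz => x l; have [[dr di] h] := phihat_partial x l => //.
by apply: le_trans (normr_Re_le (partial l phihat x)) (le_trans h (ler_norm B)).
Qed.

Let lipIm : coord_lipschitz `|B| (fun z => complex.Im (phihat z)).
Proof.
apply: partial_coord_lipschitz => x l; have [[dr di] h] := phihat_partial x l => //.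
by apply: le_trans (normr_Im_le (partial l phihat x)) (le_trans h (ler_norm B)).
Qed.

Let vanish x : ~ torus x -> phihat x = 0.
Proof.
move=> xT; have /contrapT[U /= [oU Uu] Ux] : ~ supp phihat x by move/supp_phihat.
apply/eqP; rewrite eq_complex /=; apply/andP; split; apply/eqP.
  apply: (coord_lipschitz_ae_zero lipRe oU) => //.
  by apply: filterS Uu => y yU /yU ->.
apply: (coord_lipschitz_ae_zero lipIm oU) => //.
by apply: filterS Uu => y yU /yU ->.
Qed.

(** The function h whose Fourier coefficients are the values phi(y + k). *)
Definition modulated y z : R[i] := phihat z * e2pi (inner y z).

Let tameRe : torus_tame (fun z => complex.Re (phihat z)).
Proof.
have v0 x : ~ torus x -> complex.Re (phihat x) = 0 by move=> /vanish ->.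
by split => //; [case: mphihat|exact: coord_lipschitz_bounded lipRe v0].
Qed.

Let tameIm : torus_tame (fun z => complex.Im (phihat z)).
Proof.
have v0 x : ~ torus x -> complex.Im (phihat x) = 0 by move=> /vanish ->.
by split => //; [case: mphihat|exact: coord_lipschitz_bounded lipIm v0].
Qed.

Let mwave y := cmeasurable_wave y.

Let bRe y : exists C, forall z, `|complex.Re (e2pi (inner y z))| <= C.
Proof. by exists 1 => z; exact: normr_Re_e2pi. Qed.

Let bIm y : exists C, forall z, `|complex.Im (e2pi (inner y z))| <= C.
Proof. by exists 1 => z; exact: normr_Im_e2pi. Qed.

Lemma torus_tame_modulated y : torus_tame (fun z => complex.Re (modulated y z)) /\
  torus_tame (fun z => complex.Im (modulated y z)).
Proof.
have [mr mi] := mwave y; rewrite /modulated; split.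
  under eq_fun do rewrite complexReM.
  by apply: torus_tameB; apply: torus_tameM.
under eq_fun do rewrite complexImM.
by apply: torus_tameD; apply: torus_tameM.
Qed.

Lemma cintegrable_modulated y : cintegrable setT (modulated y).
Proof.
have [tr ti] := torus_tame_modulated y.
by split; [exact: tame_integrable (torus_tameP tr)|exact: tame_integrable (torus_tameP ti)].
Qed.

Lemma coord_lipschitz_modulated y : exists K, [/\ 0 <= K,
  coord_lipschitz K (fun z => complex.Re (modulated y z)) &
  coord_lipschitz K (fun z => complex.Im (modulated y z))].
Proof.
have [_ [C ReC] _] := tameRe; have [_ [C' ImC] _] := tameIm.
have W0 := wave_lipschitz_ge0 y.
have Lc := coord_lipschitz_wave y (@cos_lipschitz R).
have Ls := coord_lipschitz_wave y (@sin_lipschitz R).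
have C0 : 0 <= C by apply: le_trans (ReC 0).
have C0' : 0 <= C' by apply: le_trans (ImC 0).
have LRe w : coord_lipschitz (wave_lipschitz y) w -> (forall z, `|w z| <= 1) ->
  coord_lipschitz (`|B| + C * wave_lipschitz y) (fun z => complex.Re (phihat z) * w z).
  by move=> Lw w1; exact: coord_lipschitzM.
have LIm w : coord_lipschitz (wave_lipschitz y) w -> (forall z, `|w z| <= 1) ->
  coord_lipschitz (`|B| + C' * wave_lipschitz y) (fun z => complex.Im (phihat z) * w z).
  by move=> Lw w1; exact: coord_lipschitzM.
exists ((`|B| + C * wave_lipschitz y) + (`|B| + C' * wave_lipschitz y)); split.
- by do ?[exact: mulr_ge0|exact: normr_ge0|apply: addr_ge0].
- rewrite /modulated; under eq_fun do rewrite complexReM.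
  apply: coord_lipschitzD; first by apply: LRe => // z; exact: cos_max.
  by apply: coord_lipschitzN; apply: LIm => // z; exact: sin_max.
- rewrite /modulated; under eq_fun do rewrite complexImM.
  apply: coord_lipschitzD; first by apply: LRe => // z; exact: sin_max.
  by apply: LIm => // z; exact: cos_max.
Qed.

(** Fourier inversion writes every phi(y + k) as an integral; summing the
exponentials under the integral sign produces the Dirichlet kernel at z - eta. *)
Lemma lattice_sumE n y eta :
  \sum_p e2pi (- inner (map_mx intr (@lattice_point d n p)) eta) *
    inv_fourier phihat (y + map_mx intr (@lattice_point d n p)) =
  (cube_sum n (fun z => complex.Re (modulated y z)) eta) +i*
  (cube_sum n (fun z => complex.Im (modulated y z)) eta).
Proof.
pose k p : 'cV[R]_d := map_mx intr (@lattice_point d n p).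
have innerDl a b z : inner (a + b) z = inner a z + inner b z.
  by rewrite /inner -big_split; apply: eq_bigr => i _; rewrite mxE mulrDl.
have innerBr a z b : inner a (z - b) = inner a z - inner a b.
  by rewrite /inner -sumrB; apply: eq_bigr => i _; rewrite !mxE mulrBr.
transitivity (cintegral setT
  (fun z => \sum_p modulated (y + k p) z * e2pi (- inner (k p) eta))).
  rewrite cintegral_sum//; last first.
    move=> p; apply: cintegrableM => //; first exact: cintegrable_modulated.
    by exists (normc (e2pi (- inner (k p) eta))).
  apply: eq_bigr => p _; rewrite cintegralZr//; last exact: cintegrable_modulated.
  by rewrite mulrC.
rewrite /cube_sum; transitivity
  (cintegral setT (fun z => modulated y z * (dirichlet_cV n (z - eta))%:C)).
  apply: eq_cintegral => z _; rewrite -sum_lattice_e2pi mulr_sumr.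
  apply: eq_bigr => p _; rewrite /modulated innerDl innerBr !e2piD.
  by rewrite -!mulrA.
rewrite /cintegral; congr Complex; apply: eq_Rintegral => z _.
  by rewrite complexReM /= mulr0 subr0.
by rewrite complexImM /= mulr0 add0r.
Qed.

End symbol.

(** * The change of variable in frequency *)

Section geometry.
Context {R : realType} {d : nat}.
Notation lam := (@lebesgue_cV R d).
Implicit Types (M : 'M[R]_d) (delta : R).

Lemma inner_mulmx M (a b : 'cV[R]_d) : inner (M *m a) b = inner a (M^T *m b).
Proof.
rewrite /inner; under eq_bigr do rewrite mxE mulr_suml.
rewrite exchange_big/=; apply: eq_bigr => j _; rewrite mxE mulr_sumr.
by apply: eq_bigr => i _; rewrite mxE mulrCA mulrA mulrAC.
Qed.

Lemma innerNl (a b : 'cV[R]_d) : inner (- a) b = - inner a b.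
Proof. by rewrite /inner -sumrN; apply: eq_bigr => i _; rewrite mxE mulNr. Qed.

Lemma dtorusE delta : 0 < delta ->
  dtorus delta = [set z : 'cV[R]_d | forall i, `|z i ord0| <= delta / 2].
Proof.
move=> d0; apply/seteqP; split => [_ [z zT <-] i|z zd].
  by rewrite mxE normrM (gtr0_norm d0) ler_pM2l.
exists (delta^-1 *: z); last by rewrite scalerA divff ?scale1r// gt_eqF.
move=> i; rewrite mxE normrM gtr0_norm ?invr_gt0// mulrC ler_pdivrMr//.
by rewrite mulrC.
Qed.

Lemma dtorus_sub delta : 0 < delta <= 1 -> dtorus delta `<=` @torus R d.
Proof.
move=> /andP[d0 d1]; rewrite dtorusE// => z zd i; apply: (le_trans (zd i)).
by rewrite ler_piMl.
Qed.

Lemma measurable_dtorus delta : 0 < delta -> measurable (@dtorus R d delta).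
Proof.
move=> d0; rewrite dtorusE// (_ : mkset _ =
    [set z : 'cV[R]_d | forall i, `[- (delta / 2), delta / 2]%classic (z i ord0)]).
  apply: (@measurable_box R d (fun=> `[- (delta / 2), delta / 2]%classic)) => i.
  exact: measurable_itv.
by apply/seteqP; split => z h i; have := h i; rewrite /= in_itv/= ler_norml.
Qed.

Lemma dMtorusE M delta : \det M != 0 ->
  dMtorus M delta = [set xi | dtorus delta (invmx M^T *m xi)].
Proof.
move=> dM; have uM : M^T \in unitmx by rewrite unitmxE det_tr unitfE.
apply/seteqP; split => [_ [z zd <-]|z zd] /=; first by rewrite mulKmx.
by exists (invmx M^T *m z) => //; rewrite mulKVmx.
Qed.

Lemma cmeasurable_comp (D : set 'cV[R]_d) (u : 'cV[R]_d -> R[i]) (P : 'M[R]_d) :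
  measurable D -> cmeasurable_fun D u ->
  cmeasurable_fun [set xi | D (P *m xi)] (fun xi => u (P *m xi)).
Proof.
move=> mD [mr mi].
have mP : measurable [set xi | D (P *m xi)].
  by rewrite -[X in measurable X]setTI; exact: measurable_mulmx_cV.
have mPf := measurable_funS measurableT (@subsetT _ [set xi | D (P *m xi)])
   (measurable_mulmx_cV P).
by split; [apply: (measurable_comp mD _ mr mPf)|apply: (measurable_comp mD _ mi mPf)];
  move=> _ [z Dz <-].
Qed.

Lemma cmeasurable_funTS (D : set 'cV[R]_d) (u : 'cV[R]_d -> R[i]) :
  cmeasurable_fun setT u -> cmeasurable_fun D u.
Proof.
by move=> [mr mi]; split; [exact: measurable_funTS mr|exact: measurable_funTS mi].
Qed.

Lemma cmeasurable_mulmx (D : set 'cV[R]_d) (u : 'cV[R]_d -> R[i]) (P : 'M[R]_d) :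
  cmeasurable_fun setT u -> cmeasurable_fun D (fun xi => u (P *m xi)).
Proof.
by move=> mu; apply: cmeasurable_funTS; exact: (cmeasurable_comp P measurableT mu).
Qed.

Lemma in_L1_cintegrable (u : 'cV[R]_d -> R[i]) : in_Lp 1%E u -> cintegrable setT u.
Proof.
move=> [[mr mi]]; rewrite Lnorm1 => fin.
have H (h : 'cV[R]_d -> R) : measurable_fun setT h ->
    (forall x, `|h x| <= normc (u x)) -> lam.-integrable setT (EFin \o h).
  move=> mh hu; apply/integrableP; split; first exact/measurable_EFinP.
  apply: le_lt_trans fin; apply: ge0_le_integral => //.
  - apply: measurableT_comp => //; exact/measurable_EFinP.
  - apply: measurableT_comp => //; apply/measurable_EFinP.
    rewrite (_ : (fun x => normc (u x)) =
        Num.sqrt \o (fun x => complex.Re (u x) ^+ 2 + complex.Im (u x) ^+ 2)).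
      apply: measurableT_comp.
        by apply: continuous_measurable_fun; exact: sqrt_continuous.
      by apply: measurable_funD; exact: measurable_funX.
    by apply/funext => x /=; case: (u x).
  - move=> x _ /=; rewrite lee_fin (le_trans (hu x))//.
    exact: ler_norm.
split; apply: H => // x; [exact: normr_Re_le|exact: normr_Im_le].
Qed.

Lemma cintegrable_cmeasurable (D : set 'cV[R]_d) (u : 'cV[R]_d -> R[i]) :
  cintegrable D u -> cmeasurable_fun D u.
Proof.
move=> [r i]; split; apply/measurable_EFinP; first exact: measurable_int r.
exact: measurable_int i.
Qed.

End geometry.

Theorem theorem29 (R : realType) (d : nat) (M : 'M[R]_d) (delta : R)
    (phi phihat : 'cV[R]_d -> R[i])
    (phit phithat : ('cV[R]_d -> R[i]) -> R[i]) (g : 'cV[R]_d -> R[i])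
    (B : R) (f fhat : 'cV[R]_d -> R[i])
    (detM : \det M != 0) (delta01 : 0 < delta <= 1)
    (phiE : forall x, phi x = inv_fourier phihat x)
    (supp_phihat : supp phihat `<=` torus)
    (phihat_Loo : in_Lp +oo%E phihat)
    (phihat_partial : forall xi l,
       has_partial l phihat xi /\ normc (partial l phihat xi) <= B)
    (phit_tempered : tempered phit)
    (phithatE : is_dist_fourier phit phithat)
    (phithat_g : dist_given_on (dtorus delta) phithat g)
    (g_measurable : cmeasurable_fun (dtorus delta) g)
    (g_bounded : exists C : R, forall xi, dtorus delta xi -> normc (g xi) <= C)
    (compatible : {ae @lebesgue_cV R d, forall xi, dtorus delta xi ->
       (phihat xi)^* * g xi = 1})
    (fE : forall x, f x = inv_fourier fhat x)
    (supp_fhat : supp fhat `<=` dMtorus M delta)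
    (fhat_L1 : in_Lp 1%E fhat) :
  forall x : 'cV[R]_d,
    (fun n : nat => \sum_(k \in [set k : 'cV[int]_d | `|k| <= n%:Z])
       pairing (dMtorus M delta) fhat (dilate_hat M k g) * dilate M k phi x
       : R[i]^o) @ \oo --> (f x : R[i]^o).
Proof.
move=> x; pose P := invmx M^T; pose D := dMtorus M delta; pose y := M *m x.
have /andP[delta0 _] := delta01.
have uM : M^T \in unitmx by rewrite unitmxE det_tr unitfE.
have uP : P \in unitmx by rewrite unitmx_inv.
have DE : D = [set xi | dtorus delta (P *m xi)] := dMtorusE delta detM.
have mdt : measurable (@dtorus R d delta) := measurable_dtorus delta0.
have mD : measurable D.
  by rewrite DE -[X in measurable X]setTI; exact: measurable_mulmx_cV.
have fT := in_L1_cintegrable fhat_L1.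
have fD : cintegrable D fhat.
  by case: fT => r i; split; apply: (integrableS measurableT mD).
(* The factor common to f(x) and to all the partial sums. *)
pose F xi := fhat xi * (g (P *m xi))^*.
have intF : cintegrable D F.
  apply: cintegrableM => //.
    have [mr mi] : cmeasurable_fun D (fun xi => g (P *m xi)).
      by rewrite DE; exact: cmeasurable_comp.
    split; first by under eq_fun do rewrite complexReJ.
    under eq_fun do rewrite complexImJ.
    exact: measurable_funN.
  by have [C gC] := g_bounded; exists C => xi; rewrite DE normc_conj; exact: gC.
have mphihat : cmeasurable_fun setT phihat by case: phihat_Loo.
have mwaveP (z : 'cV[R]_d) : cmeasurable_fun D (fun xi => e2pi (inner z (P *m xi))).
  exact: cmeasurable_mulmx (cmeasurable_wave z).
have bwave (h : 'cV[R]_d -> R) : cbounded D (fun xi => e2pi (h xi)).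
  exists 2 => xi _; apply: (le_trans (normc_le _)).
  by have := normr_Re_e2pi (h xi); have := normr_Im_e2pi (h xi); lra.
have pd_torus xi : D xi -> torus (P *m xi) by rewrite DE; exact: dtorus_sub.
have [tRe tIm] := torus_tame_modulated supp_phihat mphihat phihat_partial y.
have [K [K0 lipRe lipIm]] := coord_lipschitz_modulated supp_phihat mphihat phihat_partial y.
pose h := modulated phihat y.
have inth : cintegrable D (fun xi => F xi * h (P *m xi)).
  apply: cintegrableM => //.
    have mh : cmeasurable_fun setT h.
      by case: tRe => mr _ _; case: tIm.
    exact: cmeasurable_mulmx mh.
  case: tRe => _ [C hC] _; case: tIm => _ [C' hC'] _.
  by exists (C + C') => xi _; apply: (le_trans (normc_le _)); exact: lerD.
(* f(x) as an integral against h: this is where compatibility is used. *)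
have fxE : f x = cintegral D (fun xi => F xi * h (P *m xi)).
  have mfx : cintegrable setT (fun xi => fhat xi * e2pi (inner x xi)).
    apply: cintegrableM => //; first exact: cmeasurable_wave.
    exists 2 => xi _; apply: (le_trans (normc_le _)).
    by have := normr_Re_e2pi (inner x xi); have := normr_Im_e2pi (inner x xi); lra.
  rewrite fE /inv_fourier (cintegral_restrict mD)//; last 2 first.
  - exact: cintegrable_cmeasurable.
  - apply: filterS (ae_zero_off_supp fhat) => xi fxi xiD.
    by rewrite fxi ?mul0r// => /supp_fhat.
  apply: ae_eq_cintegral => //.
  - exact: cmeasurable_funTS (cintegrable_cmeasurable mfx).
  - exact: cintegrable_cmeasurable.
  have := negligible_preimage_mulmx uP compatible.
  apply: negligibleS => xi /= nxi H; apply: nxi => Dxi.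
  have Pxi : dtorus delta (P *m xi) by move: Dxi; rewrite DE.
  have := congr1 Num.conj (H Pxi); rewrite rmorphM/= conjCK rmorph1 => E.
  rewrite /F /h /modulated.
  have -> : inner y (P *m xi) = inner x xi by rewrite inner_mulmx mulKVmx.
  by rewrite -[LHS]mul1r -E; ring.
pose kR n (p : {ffun 'I_d -> 'I_n.*2.+1}) : 'cV[R]_d := map_mx intr (lattice_point p).
have sm0 : sqrt_m M != 0.
  by rewrite /sqrt_m eq_complex /= eqxx andbT gt_eqF// sqrtr_gt0 normr_gt0.
have smJ : (sqrt_m M)^* = sqrt_m M.
  by apply/eqP; rewrite eq_complex complexReJ complexImJ /= oppr0 !eqxx.
have intW z : cintegrable D (fun xi => F xi * e2pi (- inner z (P *m xi))).
  by apply: cintegrableM => //; under eq_fun do rewrite -innerNl.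
have intWc z c : cintegrable D (fun xi => F xi * e2pi (- inner z (P *m xi)) * c).
  by apply: cintegrableM => //; exists (normc c).
(* The powers of m cancel in each term of the sum. *)
have termE n p : pairing D fhat (dilate_hat M (@lattice_point d n p) g) *
    dilate M (lattice_point p) phi x =
    cintegral D (fun xi => F xi * e2pi (- inner (kR n p) (P *m xi)) *
      phi (y + kR n p)).
  rewrite /dilate -/(kR n p) -/y.
  have -> : pairing D fhat (dilate_hat M (lattice_point p) g) =
     cintegral D (fun xi => F xi * e2pi (- inner (kR n p) (P *m xi)) * (sqrt_m M)^-1).
    apply: eq_cintegral => xi _; rewrite /dilate_hat !rmorphM/= fmorphV/= smJ e2piJ.
    rewrite /F -/P -/(kR n p); ring.
  by rewrite !cintegralZr// mulrA mulfVK.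
(* The error of the partial Fourier sums of h at eta = P xi. *)
pose v n xi := h (P *m xi) + (\sum_p
   e2pi (- inner (kR n p) (P *m xi)) * phi (y + kR n p)) * (- 1).
have vE n : (f x = (\sum_(k \in [set k : 'cV[int]_d | `|k| <= n%:Z])
       pairing D fhat (dilate_hat M k g) * dilate M k phi x) +
       cintegral D (fun xi => F xi * v n xi)) /\ cintegrable D (fun xi => F xi * v n xi).
  rewrite cube_fsbig; under eq_bigr do rewrite termE.
  rewrite -cintegral_sum//.
  pose S xi := \sum_p F xi * e2pi (- inner (kR n p) (P *m xi)) * phi (y + kR n p).
  have intS : cintegrable D S by exact: cintegrable_sum.
  have FvE xi : F xi * v n xi = F xi * h (P *m xi) + S xi * (- 1).
    rewrite /v mulrDr mulrA mulr_sumr; congr (_ + _ * _).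
    by apply: eq_bigr => p _; rewrite mulrA.
  have intS1 : cintegrable D (fun xi => S xi * (- 1)).
    by apply: cintegrableM => //; exists (normc (- 1 : R[i])).
  split; last by under eq_fun do rewrite FvE; exact: cintegrableD.
  under [X in _ = _ + X]eq_cintegral do rewrite FvE.
  by rewrite cintegralD// cintegralZr// -fxE mulrN1 addrCA subrr addr0.
apply/cvgrPdist_le => eps; rewrite ltcE => /andP[/eqP /= eps_im eps0].
(* c times the quantity of [dirichlet_rate] bounds the error. *)
pose c := l1_bound D F * (18 * K * d%:R) *+ 2.
have c0 : 0 <= c by rewrite mulrn_wge0// !mulr_ge0// l1_bound_ge0.
have e0 : 0 < complex.Re eps / (c + 1) by rewrite divr_gt0// ltr_wpDl.
near=> n.
have rate : (Num.sqrt n.*2.+1%:R)^-1 * lebesgue_bound n ^+ d <=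
    complex.Re eps / (c + 1) by near: n; exact: dirichlet_rate.
have [fxn intv] := vE n.
rewrite fxn addrAC subrr add0r.
set e := 18 * K * (Num.sqrt n.*2.+1%:R)^-1 * (d%:R * lebesgue_bound n ^+ d).
have vb xi : D xi -> `|complex.Re (v n xi)| <= e /\ `|complex.Im (v n xi)| <= e.
  move=> Dxi; rewrite /v.
  under eq_bigr do rewrite phiE.
  rewrite (lattice_sumE supp_phihat mphihat phihat_partial) mulrN1.
  split.
    rewrite complexReD /= distrC.
    exact: cube_sum_approx (pd_torus _ Dxi).
  rewrite complexImD /= distrC.
  exact: cube_sum_approx (pd_torus _ Dxi).
have := normc_cintegralM_le mD intF intv vb.
set Z := cintegral _ _ => Zle.
rewrite lecE -[`|Z|]/((normc Z)%:C) /= eps_im eqxx /=.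
apply: (le_trans Zle).
have -> : l1_bound D F * e *+ 2 =
   c * ((Num.sqrt n.*2.+1%:R)^-1 * lebesgue_bound n ^+ d).
  rewrite /c /e; ring.
apply: (le_trans (ler_wpM2l c0 rate)).
rewrite mulrA ler_pdivrMr ?ltr_wpDl//; nra.
Unshelve. all: by end_near. Qed.
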